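(* Let the standing assumptions (see context) hold for $T,m,n,r,F,B,L_F,\varepsilon_r$, and assume in addition that $F\in C^3([0,T]\times\mathbb{R}^{m\times n};\mathbb{R}^{m\times n})$ with $\|\partial_t^aD_X^bF(t,X)\|\le M$ for all $t\in[0,T]$, $X\in\mathbb{R}^{m\times n}$ and all integers $a,b\ge0$ with $1\le a+b\le3$. Then there are $h_0>0$ and constants $C,C_T$, depending only on $m,n,r,B,L_F,M$ (and, for $C_T$, also on $T$), and in particular independent of the singular values of the numerical approximations, such that for all $0<h\le h_0$ and every rank-admissible computation with the projector-splitting Heun third-order method the following holds. (i) For a step from a rank-$r$ matrix $Y_n=U_nS_nV_n^\top$ at $0\le t_n\le T-h$, with $A_n$ the solution of $\dot A_n(s)=F(t_n+s,A_n(s))$, $A_n(0)=Y_n$, $$\|Y_n+\Delta A_n-A_n(h)\|\le C(h^4+h^2\varepsilon_r),\qquad\|Y_{n+1}-A_n(h)\|\le C(h^4+h\varepsilon_r).$$ (ii) If $A(t)$ solves $\dot A(t)=F(t,A(t))$, $A(t_0)=A_0$, on $[t_0,T]$, and the computation with $t_n=t_0+nh$ starts from a rank-$r$ matrix $Y_0=U_0S_0V_0^\top$ with $\|Y_0-A(t_0)\|\le\delta$, then $$\max_{t_n\le T}\|Y_n-A(t_n)\|\le C_T(\delta+\varepsilon_r+h^3).$$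
   Context: $\|\cdot\|$ is the Frobenius norm. $D_X^bF$ is the $b$th Fréchet derivative with respect to the matrix argument, measured in the multilinear operator norm induced by the Frobenius norm. Standing assumptions: $T>0$; $m,n,r$ are integers with $1\le r<\min(m,n)$; $F:[0,T]\times\mathbb{R}^{m\times n}\to\mathbb{R}^{m\times n}$ is continuous, and there are constants $B,L_F$ such that for all $t\in[0,T]$ and $X,Z\in\mathbb{R}^{m\times n}$, $$\|F(t,X)\|\le B,\qquad\|F(t,X)-F(t,Z)\|\le L_F\|X-Z\|;$$ and for some $\varepsilon_r\ge0$, for all $t\in[0,T]$ and every rank-$r$ matrix $Y=USV^\top$ ($U\in\mathbb{R}^{m\times r}$, $V\in\mathbb{R}^{n\times r}$ with orthonormal columns, $S\in\mathbb{R}^{r\times r}$ invertible), $$\|(I-UU^\top)F(t,Y)(I-VV^\top)\|\le\varepsilon_r.$$ Reduced $K$-$L$ step, started from $(U_0,S_0,V_0)$ with increment $\Delta A\in\mathbb{R}^{m\times n}$ (where $Y_0=U_0S_0V_0^\top$, $U_0^\top U_0=V_0^\top V_0=I_r$, $S_0$ invertible): (1) set $K_1:=U_0S_0+\Delta A\,V_0=(Y_0+\Delta A)V_0$ and compute a factorization $U_1\widehat S_1=K_1$, where $U_1\in\mathbb{R}^{m\times r}$ has orthonormal columns; (2) set $L_1:=V_0S_0^\top U_0^\top U_1+\Delta A^\top U_1=(Y_0+\Delta A)^\top U_1$ and compute a factorization $V_1S_1^\top=L_1$, where $V_1\in\mathbb{R}^{n\times r}$ has orthonormal columns. The output is $Y_1:=U_1S_1V_1^\top$.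 The step is rank-admissible when $\operatorname{rank}K_1=r$ (then also $\operatorname{rank}L_1=r$, so $S_1$ is invertible). A computation with several steps or stages is rank-admissible when every reduced $K$-$L$ step in it is rank-admissible. One step of the projector-splitting Heun third-order method from $Y_n=U_nS_nV_n^\top$ ($U_n^\top U_n=V_n^\top V_n=I_r$, $S_n$ invertible): set $F_{n,1}:=F(t_n,Y_n)$; apply the reduced $K$-$L$ step to $(U_n,S_n,V_n)$ with increment $\Delta A_{n,2}:=\frac h3F_{n,1}$, call the output $Y_{n,2}$, and set $F_{n,2}:=F(t_n+\frac h3,Y_{n,2})$; apply the reduced $K$-$L$ step to $(U_n,S_n,V_n)$ with increment $\Delta A_{n,3}:=\frac{2h}3F_{n,2}$, call the output $Y_{n,3}$, and set $F_{n,3}:=F(t_n+\frac{2h}3,Y_{n,3})$; finally apply the reduced $K$-$L$ step to $(U_n,S_n,V_n)$ with increment $\Delta A_n:=h\left(\frac14F_{n,1}+\frac34F_{n,3}\right)$; its output is $Y_{n+1}=U_{n+1}S_{n+1}V_{n+1}^\top$. *)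

(* Defs.v *)
From HB Require Import structures.
From mathcomp Require Import all_boot all_order all_algebra.
From mathcomp Require Import all_classical all_reals all_analysis.
Set Implicit Arguments.
Unset Strict Implicit.
Unset Printing Implicit Defensive.
Import Order.TTheory GRing.Theory Num.Theory.
Import numFieldNormedType.Exports.
Local Open Scope classical_set_scope.
Local Open Scope ring_scope.

(* The library norm on matrices is the max norm; it is used below only through
   the topology and the Frechet differentials it induces, which are those of
   the Frobenius norm. *)
Definition frob (R : realType) (m n : nat) (A : 'M[R]_(m, n)) : R :=
  Num.sqrt (\sum_i \sum_j A i j ^+ 2).

(* Operator norm of a b-linear map, as an extended real. *)
Definition opnorm (R : realType) (m n b : nat)
    (L : b.-tuple 'M[R]_(m, n) -> 'M[R]_(m, n)) : \bar R :=
  ereal_sup [set (frob (L H))%:E | H in [set H | forall i, frob (tnth H i) <= 1]].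

Definition diff_quot (R : realType) (m n : nat) (f : R -> 'M[R]_(m, n)) (t s : R)
  : 'M[R]_(m, n) := (s - t)^-1 *: (f s - f t).

(* One-sided at the end points when D is a closed interval. *)
Definition has_deriv_on (R : realType) (m n : nat) (D : set R)
    (f : R -> 'M[R]_(m, n)) (t : R) (l : 'M[R]_(m, n)) : Prop :=
  diff_quot f t @ within D t^' --> l.

Definition derivable_on (R : realType) (m n : nat) (D : set R)
    (f : R -> 'M[R]_(m, n)) (t : R) : Prop :=
  exists l, has_deriv_on D f t l.

Definition derive_on (R : realType) (m n : nat) (D : set R)
    (f : R -> 'M[R]_(m, n)) (t : R) : 'M[R]_(m, n) :=
  lim (diff_quot f t @ within D t^').

Definition continuous_cyl (R : realType) (m n : nat) (T : R)
    (F : R -> 'M[R]_(m, n) -> 'M[R]_(m, n)) : Prop :=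
  {within [set p : R * 'M[R]_(m, n) | 0 <= p.1 <= T],
     continuous (fun p => F p.1 p.2)}.

(* F is C^(k+1) iff its partial derivative in t and its partial Frechet
   derivative in X, applied to an arbitrary direction H, exist and are C^k. *)
Fixpoint class_C (R : realType) (m n : nat) (T : R) (k : nat)
    (F : R -> 'M[R]_(m, n) -> 'M[R]_(m, n)) : Prop :=
  continuous_cyl T F /\
  if k is k'.+1 then
    [/\ forall t X, 0 <= t <= T ->
          derivable_on `[0, T] (F ^~ X) t /\ differentiable (F t) X,
        class_C T k' (fun t X => derive_on `[0, T] (F ^~ X) t) &
        forall H, class_C T k' (fun t X => 'd (F t) X H)]
  else True.

(* dX G [:: H_1; ...; H_b] X is the b-th Frechet derivative of G at X applied
   to (H_1, ..., H_b). *)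
Fixpoint dX (R : realType) (m n : nat) (G : 'M[R]_(m, n) -> 'M[R]_(m, n))
    (Hs : seq 'M[R]_(m, n)) : 'M[R]_(m, n) -> 'M[R]_(m, n) :=
  if Hs is H :: Hs' then fun X => 'd (dX G Hs') X H else G.

(* d_t^a D_X^b F(t, X), as a function of the b directions. *)
Definition dt_dX (R : realType) (m n : nat) (T : R)
    (F : R -> 'M[R]_(m, n) -> 'M[R]_(m, n)) (a b : nat) (t : R)
    (X : 'M[R]_(m, n)) (H : b.-tuple 'M[R]_(m, n)) : 'M[R]_(m, n) :=
  iter a (derive_on `[0, T]) (fun s => dX (F s) H X) t.

Definition bounded_partials (R : realType) (m n : nat) (T : R) (k : nat) (M : R)
    (F : R -> 'M[R]_(m, n) -> 'M[R]_(m, n)) : Prop :=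
  forall (a b : nat) (t : R) (X : 'M[R]_(m, n)),
    (1 <= a + b <= k)%N -> 0 <= t <= T ->
    (opnorm (@dt_dX R m n T F a b t X) <= M%:E)%E.

Record factors (R : realType) (m n r : nat) := Factors {
  facU : 'M[R]_(m, r);
  facS : 'M[R]_r;
  facV : 'M[R]_(n, r)
}.

Definition orthonormal_cols (R : realType) (m r : nat) (U : 'M[R]_(m, r)) : Prop :=
  U^T *m U = 1%:M.

Definition is_rank_factors (R : realType) (m n r : nat) (y : factors R m n r) : Prop :=
  [/\ orthonormal_cols (facU y), orthonormal_cols (facV y) & facS y \in unitmx].

Definition fmat (R : realType) (m n r : nat) (y : factors R m n r) : 'M[R]_(m, n) :=
  facU y *m facS y *m (facV y)^T.

Definition standing_assumptions (R : realType) (m n r : nat) (T B LF eps : R)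
    (F : R -> 'M[R]_(m, n) -> 'M[R]_(m, n)) : Prop :=
  [/\ continuous_cyl T F,
      forall t X, 0 <= t <= T -> frob (F t X) <= B,
      forall t X Z, 0 <= t <= T -> frob (F t X - F t Z) <= LF * frob (X - Z),
      0 <= eps &
      forall t (y : factors R m n r), 0 <= t <= T -> is_rank_factors y ->
        frob ((1%:M - facU y *m (facU y)^T) *m F t (fmat y) *m
              (1%:M - facV y *m (facV y)^T)) <= eps].

Definition KL_K (R : realType) (m n r : nat) (y0 : factors R m n r)
    (dA : 'M[R]_(m, n)) : 'M[R]_(m, r) :=
  facU y0 *m facS y0 + dA *m facV y0.

Definition KL_L (R : realType) (m n r : nat) (y0 : factors R m n r)
    (dA : 'M[R]_(m, n)) (U1 : 'M[R]_(m, r)) : 'M[R]_(n, r) :=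
  facV y0 *m (facS y0)^T *m (facU y0)^T *m U1 + dA^T *m U1.

(* A relation: the orthonormal factorizations are not unique. *)
Definition KL_step (R : realType) (m n r : nat) (y0 : factors R m n r)
    (dA : 'M[R]_(m, n)) (y1 : factors R m n r) : Prop :=
  [/\ orthonormal_cols (facU y1),
      exists S1hat : 'M[R]_r, facU y1 *m S1hat = KL_K y0 dA,
      orthonormal_cols (facV y1) &
      facV y1 *m (facS y1)^T = KL_L y0 dA (facU y1)].

Definition KL_admissible (R : realType) (m n r : nat) (y0 : factors R m n r)
    (dA : 'M[R]_(m, n)) : Prop := \rank (KL_K y0 dA) = r.

(* In the heun_ definitions y0, y2, y3, y1 are the factors of Y_n, Y_(n,2),
   Y_(n,3), Y_(n+1). *)

Definition heun_dA2 (R : realType) (m n r : nat)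
    (F : R -> 'M[R]_(m, n) -> 'M[R]_(m, n)) (h t : R) (y0 : factors R m n r)
  : 'M[R]_(m, n) := (h / 3) *: F t (fmat y0).

Definition heun_dA3 (R : realType) (m n r : nat)
    (F : R -> 'M[R]_(m, n) -> 'M[R]_(m, n)) (h t : R) (y2 : factors R m n r)
  : 'M[R]_(m, n) := (2 * h / 3) *: F (t + h / 3) (fmat y2).

Definition heun_dA (R : realType) (m n r : nat)
    (F : R -> 'M[R]_(m, n) -> 'M[R]_(m, n)) (h t : R) (y0 y3 : factors R m n r)
  : 'M[R]_(m, n) :=
  h *: ((1 / 4) *: F t (fmat y0) + (3 / 4) *: F (t + 2 * h / 3) (fmat y3)).

Definition heun_step (R : realType) (m n r : nat)
    (F : R -> 'M[R]_(m, n) -> 'M[R]_(m, n)) (h t : R)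
    (y0 y2 y3 y1 : factors R m n r) : Prop :=
  [/\ KL_step y0 (heun_dA2 F h t y0) y2,
      KL_step y0 (heun_dA3 F h t y2) y3 &
      KL_step y0 (heun_dA F h t y0 y3) y1].

Definition heun_admissible (R : realType) (m n r : nat)
    (F : R -> 'M[R]_(m, n) -> 'M[R]_(m, n)) (h t : R)
    (y0 y2 y3 : factors R m n r) : Prop :=
  [/\ KL_admissible y0 (heun_dA2 F h t y0),
      KL_admissible y0 (heun_dA3 F h t y2) &
      KL_admissible y0 (heun_dA F h t y0 y3)].

(* Main.v *)
Require Import Defs.
From HB Require Import structures.
From mathcomp Require Import all_boot all_order all_algebra.
From mathcomp Require Import all_classical all_reals all_analysis.
From mathcomp Require Import ring lra.
Import Order.TTheory GRing.Theory Num.Theory.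
Import numFieldNormedType.Exports.
Local Open Scope classical_set_scope.
Local Open Scope ring_scope.
Set Implicit Arguments.
Unset Strict Implicit.
Unset Printing Implicit Defensive.

(** Write W = Y_n + Delta A, Q = V_n V_n^T and P = U_1 U_1^T.  A K-L step returns
P W, and P fixes W V_n, so its error is (I - P) W (I - Q) up to sign
([KL_step_projects]).  This has to be O(h^4 + h eps) although U_1 may be very
far from U_n: no singular value is bounded below.

The key is that closeness of F to the tangent spaces of all rank-r matrices,
small singular values included, is stronger than it looks.  If Y has rank at
most r, Y x = 0 and u is a vector, then Y stays a matrix of rank at most r when
its component along u is projected out, at a distance |Y^T u| / |u|; at the new
matrix both u and x are normal directions, whence
    |u^T F(Y) x| <= (eps |u| + L |Y^T u|) |x|     ([tangency_bilinear]).
By a Tikhonov regularization this dual inequality yields a G of size O(L) with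
F(Y) x = Y (G x) + O(eps) ([tangent_selection]): the flow moves the kernel of Y
at bounded speed, whatever the singular values are.  Following the kernel along
a curve that starts at Y_n, in small Euler substeps, gives
([kernel_transport]) a matrix N = (I + E)(I - Q) with |E| <= 1/2 that the
matrix p(s) at time s of that curve almost annihilates: |p(s) N| = O(s eps) up
to the defect of the curve.  Since N is a perturbation of I - Q,
([KL_step_error]) turns this into
    |Y_1 - W| <= 3 |W - p(s)| + 2 |p(s) N|.

The curve is the cubic p(s) = Y_n + s k1 + s^2/2 a2 + s^3/6 a3, the Taylor
polynomial of the exact solution, for which
|p'(s) - F(t + s, p(s))| = O(s^3) ([model_curve]).  Expanding F along it first
in t and then along unit directions in X involves exactly the derivatives that
are bounded by M, those that act first in X and then in t.  The stages then
satisfy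
    Y_(n,2) - p(h/3) = O(h^2 + h eps),  Y_(n,3) - p(2h/3) = O(h^3 + h eps),
    W - p(h) = O(h^4 + h^2 eps),        Y_(n+1) - p(h) = O(h^4 + h eps),
because the weights 1/4, 3/4 integrate the quadratic p' exactly
([heun_stage2], [heun_stage3], [heun_increment], [heun_output]).  Any exact
solution A satisfies |A(h) - p(h)| <= (1 + 2 L h) |A(0) - Y_n| + O(h^4)
([curve_stability]).  With A(0) = Y_n this is the local estimate; with A(0) on
the given trajectory it is the recursion for the global error, and
[recursion_bound] sums it. *)

(** * The Frobenius inner product and orthogonal projectors *)

Definition dot (R : realType) (m n : nat) (A B : 'M[R]_(m, n)) : R :=
  \sum_i \sum_j A i j * B i j.

Section Frob.
Variable R : realType.

Lemma dotE m n (A B : 'M[R]_(m, n)) : dot A B = \tr (A^T *m B).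
Proof.
rewrite /dot exchange_big /mxtrace; apply: eq_bigr => j _.
by rewrite mxE; apply: eq_bigr => i _; rewrite mxE.
Qed.

Lemma dotC m n (A B : 'M[R]_(m, n)) : dot A B = dot B A.
Proof. by apply: eq_bigr => i _; apply: eq_bigr => j _; rewrite mulrC. Qed.

Lemma dotDr m n (A B C : 'M[R]_(m, n)) : dot A (B + C) = dot A B + dot A C.
Proof. by rewrite !dotE mulmxDr mxtraceD. Qed.

Lemma dotZr m n (A B : 'M[R]_(m, n)) a : dot A (a *: B) = a * dot A B.
Proof. by rewrite !dotE -scalemxAr mxtraceZ. Qed.

Lemma dotNr m n (A B : 'M[R]_(m, n)) : dot A (- B) = - dot A B.
Proof. by rewrite -scaleN1r dotZr mulN1r. Qed.

Lemma dotBr m n (A B C : 'M[R]_(m, n)) : dot A (B - C) = dot A B - dot A C.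
Proof. by rewrite dotDr dotNr. Qed.

Lemma dotDl m n (A B C : 'M[R]_(m, n)) : dot (B + C) A = dot B A + dot C A.
Proof. by rewrite ![dot _ A]dotC dotDr. Qed.

Lemma dotZl m n (A B : 'M[R]_(m, n)) a : dot (a *: B) A = a * dot B A.
Proof. by rewrite ![dot _ A]dotC dotZr. Qed.

Lemma dot_ge0 m n (A : 'M[R]_(m, n)) : 0 <= dot A A.
Proof. by apply: sumr_ge0 => i _; apply: sumr_ge0 => j _; rewrite -expr2 sqr_ge0. Qed.

Lemma frob_sqr m n (A : 'M[R]_(m, n)) : frob A ^+ 2 = dot A A.
Proof. exact: sqr_sqrtr (dot_ge0 A). Qed.

Lemma frob_ge0 m n (A : 'M[R]_(m, n)) : 0 <= frob A.
Proof. exact: sqrtr_ge0. Qed.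

Lemma frob_le m n p q (A : 'M[R]_(m, n)) (B : 'M[R]_(p, q)) :
  (frob A <= frob B) = (dot A A <= dot B B).
Proof. by rewrite -!frob_sqr ler_pXn2r ?nnegrE ?frob_ge0. Qed.

Lemma frob_le_sqr m n (A : 'M[R]_(m, n)) (c : R) :
  0 <= c -> dot A A <= c ^+ 2 -> frob A <= c.
Proof. by move=> c0; rewrite -frob_sqr ler_pXn2r ?nnegrE ?frob_ge0. Qed.

Lemma entry_le_frob m n (A : 'M[R]_(m, n)) i j : `|A i j| <= frob A.
Proof.
rewrite -(@ler_pXn2r _ 2) ?nnegrE ?frob_ge0 // frob_sqr real_normK ?num_real //.
rewrite /dot (bigD1 i) //= (bigD1 j) //= -expr2 -addrA lerDl addr_ge0 //.
  by apply: sumr_ge0 => k _; rewrite -expr2 sqr_ge0.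
by apply: sumr_ge0 => k _; apply: sumr_ge0 => l _; rewrite -expr2 sqr_ge0.
Qed.

Lemma frob_eq0 m n (A : 'M[R]_(m, n)) : frob A = 0 -> A = 0.
Proof.
move=> A0; apply/matrixP => i j; rewrite mxE; apply/normr0_eq0/le_anti.
by rewrite normr_ge0 andbT -A0 entry_le_frob.
Qed.

Lemma frobZ m n (A : 'M[R]_(m, n)) a : frob (a *: A) = `|a| * frob A.
Proof.
apply/eqP; rewrite -(@eqrXn2 _ 2) ?frob_ge0 ?mulr_ge0 ?frob_ge0 //.
rewrite exprMn !frob_sqr dotZl dotZr mulrA -expr2.
by rewrite real_normK ?num_real.
Qed.

Lemma frob0 m n : frob (0 : 'M[R]_(m, n)) = 0.
Proof. by rewrite -(scale0r (0 : 'M[R]_(m, n))) frobZ normr0 mul0r. Qed.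

Lemma frobN m n (A : 'M[R]_(m, n)) : frob (- A) = frob A.
Proof. by rewrite -scaleN1r frobZ normrN normr1 mul1r. Qed.

Lemma frobBC m n (A B : 'M[R]_(m, n)) : frob (A - B) = frob (B - A).
Proof. by rewrite -frobN opprB. Qed.

Lemma frob_trmx m n (A : 'M[R]_(m, n)) : frob A^T = frob A.
Proof.
rewrite /frob exchange_big; congr Num.sqrt.
by apply: eq_bigr => i _; apply: eq_bigr => j _; rewrite mxE.
Qed.

Lemma dot_le m n (A B : 'M[R]_(m, n)) : dot A B <= frob A * frob B.
Proof.
have [B0|Bn0] := eqVneq (frob B) 0.
  rewrite (frob_eq0 B0) frob0 mulr0 -(scale0r (0 : 'M[R]_(m, n))) dotZr.
  by rewrite mul0r.
have Bp : 0 < frob B by rewrite lt_neqAle eq_sym Bn0 frob_ge0.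
apply: (@le_trans _ _ `|dot A B|); first exact: ler_norm.
rewrite -(@ler_pXn2r _ 2) ?nnegrE ?mulr_ge0 ?frob_ge0 //.
rewrite real_normK ?num_real // exprMn.
pose c := dot A B / frob B ^+ 2.
have := dot_ge0 (A - c *: B).
rewrite -scaleNr !dotDr !dotDl !dotZr !dotZl (dotC B A) -!frob_sqr.
have -> : frob A ^+ 2 + - c * dot A B +
   (- c * dot A B + - c * (- c * frob B ^+ 2))
   = frob A ^+ 2 - dot A B ^+ 2 / frob B ^+ 2.
  by rewrite /c; field.
by rewrite subr_ge0 ler_pdivrMr ?exprn_gt0.
Qed.

Lemma dot_norm_le m n (A B : 'M[R]_(m, n)) : `|dot A B| <= frob A * frob B.
Proof. by rewrite ler_norml dot_le andbT lerNl -dotNr -(frobN B) dot_le. Qed.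

Lemma frobD m n (A B : 'M[R]_(m, n)) : frob (A + B) <= frob A + frob B.
Proof.
apply: frob_le_sqr; first by rewrite addr_ge0 ?frob_ge0.
rewrite !dotDr !dotDl (dotC B A) -!frob_sqr.
have := dot_le A B; lra.
Qed.

Lemma frobB m n (A B : 'M[R]_(m, n)) : frob (A - B) <= frob A + frob B.
Proof. by rewrite -(frobN B) frobD. Qed.

Lemma frob_dist m n (A B C : 'M[R]_(m, n)) :
  frob (A - C) <= frob (A - B) + frob (B - C).
Proof. by apply: le_trans (frobD _ _); rewrite addrA subrK. Qed.

(** Testing against all matrices reduces the mean value inequality for
matrix-valued functions to the scalar mean value theorem. *)
Lemma frob_dual m n (A : 'M[R]_(m, n)) (c : R) :
  0 <= c -> (forall W, dot W A <= c * frob W) -> frob A <= c.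
Proof.
move=> c0 H; have [->//|An0] := eqVneq (frob A) 0.
have Ap : 0 < frob A by rewrite lt_neqAle eq_sym An0 frob_ge0.
by have := H A; rewrite -frob_sqr expr2 ler_pM2r.
Qed.

Lemma frobM m n p (A : 'M[R]_(m, n)) (B : 'M[R]_(n, p)) :
  frob (A *m B) <= frob A * frob B.
Proof.
apply: frob_le_sqr; first by rewrite mulr_ge0 ?frob_ge0.
rewrite exprMn !frob_sqr {1 2}/dot mulr_suml; apply: ler_sum => i _.
rewrite [dot B B]exchange_big mulr_sumr; apply: ler_sum => j _.
have /(lerXn2r 2) := dot_norm_le (row i A) (col j B)^T.
rewrite !nnegrE normr_ge0 mulr_ge0 ?frob_ge0 // => /(_ isT isT).
rewrite real_normK ?num_real // exprMn !frob_sqr /dot !big_ord1.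
have -> : \sum_k row i A 0 k * (col j B)^T 0 k = (A *m B) i j.
  by rewrite mxE; apply: eq_bigr => k _; rewrite !mxE.
have -> : \sum_k row i A 0 k * row i A 0 k = \sum_k A i k * A i k.
  by apply: eq_bigr => k _; rewrite !mxE.
have -> : \sum_k (col j B)^T 0 k * (col j B)^T 0 k = \sum_k B k j * B k j.
  by apply: eq_bigr => k _; rewrite !mxE.
by rewrite expr2.
Qed.

Lemma col_mulmx m n p (A : 'M[R]_(m, n)) (B : 'M[R]_(n, p)) j :
  col j (A *m B) = A *m col j B.
Proof. by rewrite !colE mulmxA. Qed.

Lemma frob_col m n (A : 'M[R]_(m, n)) j : frob (col j A) <= frob A.
Proof.
rewrite frob_le /dot; apply: ler_sum => i _; rewrite big_ord1 mxE.
by rewrite (bigD1 j) //= lerDl sumr_ge0 // => k _; rewrite -expr2 sqr_ge0.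
Qed.

Lemma dot_adj m n p (A : 'M[R]_(m, n)) (B : 'M[R]_(n, p)) C :
  dot (A *m B) C = dot B (A^T *m C).
Proof. by rewrite !dotE trmx_mul mulmxA. Qed.

(** U U^T and I - U U^T are complementary orthogonal projectors. *)
Lemma frob_pyth m r n (U : 'M[R]_(m, r)) (X : 'M[R]_(m, n)) :
  orthonormal_cols U ->
  dot X X = dot (U *m U^T *m X) (U *m U^T *m X) +
    dot ((1%:M - U *m U^T) *m X) ((1%:M - U *m U^T) *m X).
Proof.
move=> hU.
have : (U *m U^T)^T = U *m U^T by rewrite trmx_mul trmxK.
have : U *m U^T *m (U *m U^T) = U *m U^T.
  by rewrite mulmxA -(mulmxA U) hU mulmx1.
move: (U *m U^T) => P PP PT.
have QT : (1%:M - P)^T = 1%:M - P by rewrite linearB /= trmx1 PT.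
have QQ : (1%:M - P) *m (1%:M - P) = 1%:M - P.
  by rewrite mulmxBr mulmx1 mulmxBl mul1mx PP subrr subr0.
rewrite !dot_adj PT QT !mulmxA PP QQ.
by rewrite -dotDr -mulmxDl addrC subrK mul1mx.
Qed.

Lemma frob_proj m r n (U : 'M[R]_(m, r)) (X : 'M[R]_(m, n)) :
  orthonormal_cols U -> frob (U *m U^T *m X) <= frob X.
Proof. by move=> hU; rewrite frob_le (frob_pyth X hU) lerDl dot_ge0. Qed.

Lemma frob_coproj m r n (U : 'M[R]_(m, r)) (X : 'M[R]_(m, n)) :
  orthonormal_cols U -> frob ((1%:M - U *m U^T) *m X) <= frob X.
Proof. by move=> hU; rewrite frob_le [leRHS](frob_pyth X hU) lerDr dot_ge0. Qed.

Lemma frob_projr m r n (V : 'M[R]_(n, r)) (X : 'M[R]_(m, n)) :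
  orthonormal_cols V -> frob (X *m (V *m V^T)) <= frob X.
Proof.
by move=> hV; rewrite -frob_trmx !trmx_mul trmxK -[leRHS]frob_trmx frob_proj.
Qed.

Lemma frob_coprojr m r n (V : 'M[R]_(n, r)) (X : 'M[R]_(m, n)) :
  orthonormal_cols V -> frob (X *m (1%:M - V *m V^T)) <= frob X.
Proof.
move=> hV; rewrite -frob_trmx !trmx_mul -[leRHS]frob_trmx.
by rewrite linearB /= trmx1 trmx_mul trmxK frob_coproj.
Qed.

End Frob.

(** * Orthonormal frames *)

Section Frames.
Variable R : realType.

Lemma frob_cV1 m (u : 'cV[R]_m) : frob u = 1 <-> u^T *m u = 1%:M.
Proof.
have E : (u^T *m u) = (frob u ^+ 2)%:M.
  rewrite frob_sqr dotE; apply/matrixP => i j; rewrite !ord1.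
  by rewrite /mxtrace big_ord1 [in RHS]mxE eqxx mulr1n.
rewrite E; split=> [->|H]; first by rewrite expr1n.
have := congr1 (fun X : 'M[R]_1 => X 0 0) H; rewrite !mxE eqxx !mulr1n => /eqP.
by rewrite sqrf_eq1 => /orP[/eqP//|/eqP H2]; have := frob_ge0 u; lra.
Qed.

Lemma frob_normalize m n (w : 'M[R]_(m, n)) : w != 0 -> frob ((frob w)^-1 *: w) = 1.
Proof.
move=> w0; have f0 : frob w != 0 by apply: contraNneq w0 => /frob_eq0 ->.
by rewrite frobZ ger0_norm ?invr_ge0 ?frob_ge0 // mulVf.
Qed.

Lemma unit_vector_orthogonal m k (U : 'M[R]_(m, k)) :
  (k < m)%N -> exists w : 'cV[R]_m, frob w = 1 /\ U^T *m w = 0.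
Proof.
move=> km; have : kermx U != 0.
  rewrite -mxrank_eq0 mxrank_ker -lt0n subn_gt0.
  exact: leq_ltn_trans (rank_leq_col U) km.
move=> /rowV0Pn[v /sub_kermxP vU v0].
exists ((frob v^T)^-1 *: v^T); split.
  by rewrite frob_normalize // trmx_eq0.
by rewrite -scalemxAr -trmx_mul vU trmx0 scaler0.
Qed.

(** A QR factorization inside the orthogonal complement of u that also covers a
rank-deficient K.  The columns are treated one by one: the new frame vector is
the normalized component of the column outside the span found so far, or, if
that vanishes, any unit vector orthogonal to u and to this span, which exists
because r < m. *)
Lemma frame_orthogonal_to m r (u : 'cV[R]_m) (K : 'M[R]_(m, r)) :
  (r < m)%N -> frob u = 1 -> u^T *m K = 0 ->
  exists U : 'M[R]_(m, r),
    [/\ orthonormal_cols U, u^T *m U = 0 & U *m (U^T *m K) = K].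
Proof.
elim: r K => [|r IH] K rm u1 uK.
  by exists K; split => //; [apply/matrixP => -[]|apply/matrixP => i []].
move: K uK; rewrite -[r.+1]/(1 + r)%N => K.
rewrite -(hsubmxK K); set k := lsubmx K; set K' := rsubmx K.
rewrite mul_mx_row -(row_mx0 R 1 1 r) => /eq_row_mx [uk uK'].
have [U [hU uU KU]] := IH K' (ltnW rm) u1 uK'.
have [w [w1 wu wU [a kE]]] : exists w : 'cV[R]_m,
    [/\ frob w = 1, u^T *m w = 0, U^T *m w = 0 &
        exists a : R, k = U *m (U^T *m k) + a *: w].
  have [d0|dn0] := eqVneq (k - U *m (U^T *m k)) 0.
    have [w [w1 H]] := @unit_vector_orthogonal m (1 + r) (row_mx u U) rm.
    move: H; rewrite tr_row_mx mul_col_mx -(col_mx0 R 1 r 1) => /eq_col_mx [H1 H2].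
    exists w; split => //; exists 0; rewrite scale0r addr0; exact: subr0_eq d0.
  set d := k - _ in dn0; exists ((frob d)^-1 *: d); split.
  - exact: frob_normalize.
  - by rewrite -scalemxAr mulmxBr uk (mulmxA u^T) uU mul0mx subr0 scaler0.
  - by rewrite -scalemxAr mulmxBr (mulmxA U^T) hU mul1mx subrr scaler0.
  exists (frob d); rewrite scalerA mulfV ?scale1r; first by rewrite addrC subrK.
  by apply: contraNneq dn0 => /frob_eq0 ->.
have wU' : w^T *m U = 0 by rewrite -[LHS]trmxK trmx_mul trmxK wU trmx0.
have ww : w^T *m w = 1%:M by apply/frob_cV1.
exists (row_mx w U); split.
- by rewrite /orthonormal_cols tr_row_mx mul_col_row ww wU wU' hU -scalar_mx_block.
- by rewrite mul_mx_row wu uU row_mx0.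
rewrite tr_row_mx mul_col_row mul_row_block; congr row_mx.
  rewrite {1}kE mulmxDr -scalemxAr mulmxA wU' mul0mx add0r ww.
  by rewrite -scalemxAr mulmx1 addrC -kE.
rewrite KU -{1}KU (mulmxA w^T) wU' mul0mx mulmx0.
by rewrite add0r.
Qed.

(** The characteristic polynomial of -S has at most r roots, so one of the r + 1
numbers d, d/2, ..., d/(r + 1) is not a root. *)
Lemma unitmx_small_shift r (S : 'M[R]_r) (d : R) : 0 < d ->
  exists2 e : R, 0 < e <= d & S + e%:M \in unitmx.
Proof.
move=> d0; pose rs := [seq d / k.+1%:R | k <- iota 0 r.+1].
have p0 : char_poly (- S) != 0 by rewrite monic_neq0 // char_poly_monic.
have urs : uniq rs.
  rewrite map_inj_uniq ?iota_uniq // => i j /(mulfI (lt0r_neq0 d0)) /invr_inj.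
  by move/eqP; rewrite eqr_nat => /eqP [].
have [/(max_poly_roots p0)|] := boolP (all (root (char_poly (- S))) rs).
  by move/(_ urs); rewrite size_char_poly size_map size_iota ltnn.
rewrite -has_predC => /hasP [e /mapP[k _ ->] /=]; rewrite rootE => He.
exists (d / k.+1%:R).
  by rewrite divr_gt0 ?ltr0Sn //= ler_pdivrMr ?ltr0Sn // ler_peMr ?(ltW d0) // ler1n.
rewrite unitmxE unitfE; apply: contra He => /eqP He.
rewrite /char_poly -horner_evalE -det_map_mx -He; apply/eqP; congr (\det _).
apply/matrixP => i j; rewrite !mxE /= horner_evalE !hornerE.
by rewrite addrC; case: (i == j); rewrite ?mulr1n ?mulr0n ?hornerE ?opprK.
Qed.

End Frames.

(** * Consequences of closeness to the tangent spaces *)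

Section Tangency.
Variables (R : realType) (m n r : nat) (f : 'M[R]_(m, n) -> 'M[R]_(m, n)).
Variables (L eps : R).
Hypotheses (rm : (r < m)%N) (rn : (r < n)%N) (L0 : 0 < L) (eps0 : 0 <= eps).
Hypothesis f_lip : forall X Z, frob (f X - f Z) <= L * frob (X - Z).
Hypothesis f_tan : forall y : factors R m n r, is_rank_factors y ->
  frob ((1%:M - facU y *m (facU y)^T) *m f (fmat y) *m
        (1%:M - facV y *m (facV y)^T)) <= eps.

(** Projecting out u moves Y = K Lm^T by |Y^T u|.  The result factors through
frames U orthogonal to u and V orthogonal to x, and a small multiple of the
identity added to its core makes it a genuine rank-r matrix; the slack a - eps
absorbs this shift.  There u and x are normal to the rank-r matrices, so the
tangency hypothesis bounds u^T f x by eps, and the Lipschitz bound carries the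
estimate back to Y. *)
Lemma tangency_unit (K : 'M[R]_(m, r)) (Lm : 'M[R]_(n, r))
    (u : 'cV[R]_m) (x : 'cV[R]_n) (a : R) :
  eps < a -> frob u = 1 -> frob x = 1 -> Lm^T *m x = 0 ->
  dot u (f (K *m Lm^T) *m x) <= a + L * frob ((K *m Lm^T)^T *m u).
Proof.
move=> ea u1 x1 Lx; set Y := K *m Lm^T.
have uu : u^T *m u = 1%:M by apply/frob_cV1.
have uK : u^T *m ((1%:M - u *m u^T) *m K) = 0.
  by rewrite mulmxA mulmxBr mulmx1 mulmxA uu mul1mx subrr mul0mx.
have xL : x^T *m Lm = 0 by rewrite -[LHS]trmxK trmx_mul trmxK Lx trmx0.
have [U [hU uU UK]] := frame_orthogonal_to rm u1 uK.
have [V [hV xV VL]] := frame_orthogonal_to rn x1 xL.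
set K' := _ *m K in uK UK.
pose c := frob (U *m V^T).
have c0 : 0 <= c by exact: frob_ge0.
have d0 : 0 < (a - eps) / (L * (1 + c)).
  by rewrite divr_gt0 ?subr_gt0 // mulr_gt0 // ltr_wpDr.
have [e /andP[e0 ed] Se] := unitmx_small_shift (U^T *m K' *m Lm^T *m V) d0.
pose y := Factors U (U^T *m K' *m Lm^T *m V + e%:M) V.
have hy : is_rank_factors y by split.
have YE : Y - fmat y = u *m (u^T *m Y) - e *: (U *m V^T).
  have VLt : Lm^T *m V *m V^T = Lm^T.
    by apply: trmx_inj; rewrite !trmx_mul !trmxK VL.
  have core : U *m (U^T *m K' *m Lm^T *m V) *m V^T = K' *m Lm^T.
    by rewrite -[in RHS]UK -[in RHS]VLt !mulmxA.
  rewrite /fmat /= mulmxDr mulmxDl core mul_mx_scalar -scalemxAl opprD addrA.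
  congr (_ - _); rewrite /K' mulmxBl mul1mx mulmxBl -/Y.
  by rewrite opprB addrC subrK /Y !mulmxA.
have dist : frob (Y - fmat y) <= frob (Y^T *m u) + e * c.
  rewrite YE; apply: le_trans (frobB _ _) _; rewrite frobZ ger0_norm ?(ltW e0) //.
  rewrite lerD2r; apply: le_trans (frobM _ _) _.
  by rewrite u1 mul1r -frob_trmx trmx_mul trmxK.
have -> : f Y *m x = (1%:M - U *m U^T) *m f (fmat y) *m (1%:M - V *m V^T) *m x
    + U *m U^T *m (f (fmat y) *m x) + (f Y - f (fmat y)) *m x.
  have xV' : V^T *m x = 0 by rewrite -[LHS]trmxK trmx_mul trmxK xV trmx0.
  rewrite -[_ *m _ *m (1%:M - _) *m x]mulmxA [(1%:M - V *m V^T) *m x]mulmxBl mul1mx.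
  rewrite -[V *m _ *m x]mulmxA xV' mulmx0 subr0 -mulmxA mulmxBl mul1mx.
  by rewrite subrK mulmxBl addrC subrK.
rewrite !dotDr.
have -> : dot u (U *m U^T *m (f (fmat y) *m x)) = 0.
  by rewrite dotE !mulmxA uU !mul0mx mxtrace0.
have h1 := dot_le u ((1%:M - U *m U^T) *m f (fmat y) *m (1%:M - V *m V^T) *m x).
have h2 := frobM ((1%:M - U *m U^T) *m f (fmat y) *m (1%:M - V *m V^T)) x.
have h3 := f_tan hy.
have h4 := dot_le u ((f Y - f (fmat y)) *m x).
have h5 := frobM (f Y - f (fmat y)) x.
have h6 := f_lip Y (fmat y).
have h7 : L * frob (Y - fmat y) <= L * frob (Y^T *m u) + L * (e * c).
  by rewrite -mulrDr ler_pM2l.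
have h8 : L * (e * c) <= a - eps.
  have : L * (e * c) <= L * (e * (1 + c)).
    by rewrite ler_pM2l // ler_pM2l // lerDr.
  move/le_trans; apply.
  by move: ed; rewrite ler_pdivlMr ?mulr_gt0 ?ltr_wpDr // mulrCA.
move: h1 h2 h4 h5; rewrite u1 x1 !mul1r !mulr1 /= in h3 *.
lra.
Qed.

Lemma tangency_bilinear (K : 'M[R]_(m, r)) (Lm : 'M[R]_(n, r))
    (u : 'cV[R]_m) (x : 'cV[R]_n) (a : R) :
  eps < a -> Lm^T *m x = 0 ->
  dot u (f (K *m Lm^T) *m x)
    <= (a * frob u + L * frob ((K *m Lm^T)^T *m u)) * frob x.
Proof.
move=> ea Lx.
have a0 : 0 <= a by rewrite ltW // (le_lt_trans eps0).
have [x0|xn0] := eqVneq x 0.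
  by rewrite x0 mulmx0 frob0 mulr0 -(scale0r 0) dotZr mul0r.
have [u0|un0] := eqVneq u 0.
  rewrite u0 -(scale0r 0) dotZl mul0r scale0r mulmx0 !frob0.
  by rewrite !mulr0 addr0 mul0r.
have H := @tangency_unit K Lm _ _ a ea (frob_normalize un0) (frob_normalize xn0).
have {H} := H _; rewrite -!scalemxAr Lx scaler0 => /(_ erefl).
rewrite dotZl dotZr frobZ.
have xp : 0 < frob x.
  by rewrite lt_neqAle frob_ge0 andbT eq_sym; apply: contraNneq xn0 => /frob_eq0 ->.
have up : 0 < frob u.
  by rewrite lt_neqAle frob_ge0 andbT eq_sym; apply: contraNneq un0 => /frob_eq0 ->.
rewrite ger0_norm ?invr_ge0 ?frob_ge0 // mulrCA mulrA -invfM.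
rewrite ler_pdivrMl ?mulr_gt0 //.
move/le_trans; apply; rewrite le_eqVlt; apply/orP; left; apply/eqP.
by field; rewrite gt_eqF.
Qed.

(** The multiplier is G = Y^T U with U = (Y Y^T + e I)^-1 f(Y) N, a Tikhonov
regularization: its residual is e U, and |G|^2 + e |U|^2 is the inner product of
U with f(Y) N, which [tangency_bilinear], applied to each pair of columns,
bounds by k (a |U| + L |G|) with k = p nu.  With e = (a/L)^2 the two summands
balance, and both |G| and the residual are controlled independently of the
singular values of Y. *)
Lemma tangent_selection (K : 'M[R]_(m, r)) (Lm : 'M[R]_(n, r)) p
    (N : 'M[R]_(n, p)) (a nu : R) :
  eps < a -> Lm^T *m N = 0 -> frob N <= nu ->
  exists G : 'M[R]_(n, p),
    frob G <= 2 * (p%:R * nu * L) /\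
    frob (f (K *m Lm^T) *m N - K *m Lm^T *m G) <= 2 * (p%:R * nu * a).
Proof.
move=> ea LN Nnu; set Y := K *m Lm^T.
have a0 : 0 < a by exact: le_lt_trans eps0 ea.
have nu0 : 0 <= nu by exact: le_trans (frob_ge0 N) Nnu.
pose e := (a / L) ^+ 2.
have e0 : 0 < e by rewrite exprn_gt0 // divr_gt0.
have qf q (w : 'M[R]_(m, q)) :
    dot w ((Y *m Y^T + e%:M) *m w) = frob (Y^T *m w) ^+ 2 + e * frob w ^+ 2.
  by rewrite mulmxDl dotDr mul_scalar_mx dotZr -mulmxA !frob_sqr dot_adj trmxK.
have Hu : Y *m Y^T + e%:M \in unitmx.
  rewrite -row_free_unit -kermx_eq0; apply/eqP/row_matrixP => i.
  rewrite row0; set v := row i _.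
  have vk : v *m (Y *m Y^T + e%:M) = 0 by apply/sub_kermxP; exact: row_sub.
  have := qf _ v^T; have -> : (Y *m Y^T + e%:M) *m v^T = 0.
    have S : (Y *m Y^T + e%:M)^T = Y *m Y^T + e%:M.
      by rewrite linearD /= trmx_mul trmxK tr_scalar_mx.
    by rewrite -S -trmx_mul vk trmx0.
  rewrite -(scale0r 0) dotZr mul0r => /esym/eqP.
  rewrite paddr_eq0 ?sqr_ge0 ?(mulr_ge0 (ltW e0)) ?sqr_ge0 // => /andP[_].
  rewrite mulf_eq0 gt_eqF //= sqrf_eq0 => /eqP /frob_eq0 /(congr1 trmx).
  by rewrite trmxK trmx0.
pose U := invmx (Y *m Y^T + e%:M) *m (f Y *m N).
have HU : (Y *m Y^T + e%:M) *m U = f Y *m N by rewrite /U mulKVmx.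
exists (Y^T *m U).
have res : f Y *m N - Y *m (Y^T *m U) = e *: U.
  by rewrite -HU mulmxDl mul_scalar_mx mulmxA addrC addKr.
rewrite res frobZ ger0_norm ?(ltW e0) //.
have := qf _ U; rewrite HU.
have bnd : dot U (f Y *m N)
    <= p%:R * ((a * frob U + L * frob (Y^T *m U)) * nu).
  have -> : dot U (f Y *m N) = \sum_j dot (col j U) (f Y *m col j N).
    rewrite /dot exchange_big; apply: eq_bigr => j _; apply: eq_bigr => i _.
    by rewrite big_ord1 -col_mulmx !mxE.
  apply: (@le_trans _ _ (\sum_(j < p) ((a * frob U + L * frob (Y^T *m U)) * nu))).
    apply: ler_sum => j _.
    have LNj : Lm^T *m col j N = 0 by rewrite -col_mulmx LN col0.
    apply: le_trans (tangency_bilinear K _ ea LNj) _.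
    have H1 := frob_col U j; have H2 := frob_col (Y^T *m U) j.
    apply: ler_pM => //; rewrite ?frob_ge0 //.
    - by rewrite addr_ge0 ?mulr_ge0 ?frob_ge0 ?(ltW a0) ?(ltW L0).
    - by rewrite lerD // ler_pM2l // -col_mulmx.
    - exact: le_trans (frob_col N j) Nnu.
  by rewrite sumr_const card_ord -[leLHS]mulr_natl.
set P := frob (Y^T *m U) in bnd *; set q := frob U in bnd *.
have P0 : 0 <= P by exact: frob_ge0.
have q0 : 0 <= q by exact: frob_ge0.
pose q' := a / L * q.
have q'0 : 0 <= q' by rewrite mulr_ge0 // ltW // divr_gt0.
have -> : e * q ^+ 2 = q' ^+ 2 by rewrite /e /q' [RHS]exprMn.
have -> : e * q = a / L * q' by rewrite /e /q' expr2 [RHS]mulrA.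
have aq : a * q = L * q' by rewrite /q'; field; rewrite gt_eqF.
move=> E; move: bnd; rewrite E aq => bnd.
set k := p%:R * nu; have k0 : 0 <= k by rewrite mulr_ge0.
have {}bnd : P ^+ 2 + q' ^+ 2 <= k * L * (P + q').
  by move: bnd; rewrite /k; congr (_ <= _); ring.
have kL : 0 <= k * L by rewrite mulr_ge0 // ltW.
have sum_le : P + q' <= 2 * (k * L).
  have [s0|sp] := leP (P + q') 0; first by apply: le_trans s0 _; rewrite mulr_ge0.
  rewrite -(ler_pM2r sp).
  have : 0 <= (P - q') ^+ 2 by exact: sqr_ge0.
  by move: bnd; nra.
split; first by apply: le_trans sum_le; rewrite lerDl.
have : a / L * q' <= a / L * (2 * (k * L)).
  rewrite ler_pM2l ?divr_gt0 //; apply: le_trans sum_le; by rewrite lerDr.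
move/le_trans; apply; rewrite le_eqVlt; apply/orP; left; apply/eqP.
by field; rewrite gt_eqF.
Qed.

End Tangency.

(** * Transport of the kernel along a curve *)


Section Perturbation.
Variable R : realType.

(** The Neumann series bound |(I + E)^-1| <= 2, stated without the inverse. *)
Lemma frob_solve_le p q (E : 'M[R]_p) (X : 'M[R]_(p, q)) :
  frob E <= 1 / 2 -> frob X <= 2 * frob ((1%:M + E) *m X).
Proof.
move=> hE.
have h1 : frob X <= frob ((1%:M + E) *m X) + frob (E *m X).
  by apply: le_trans (frobB _ _); rewrite mulmxDl mul1mx addrK.
have h2 : frob (E *m X) <= 1 / 2 * frob X.
  by apply: le_trans (frobM _ _) _; rewrite ler_wpM2r ?frob_ge0.
lra.
Qed.

Lemma frob_solver_le p q (E : 'M[R]_p) (X : 'M[R]_(q, p)) :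
  frob E <= 1 / 2 -> frob X <= 2 * frob (X *m (1%:M + E)).
Proof.
move=> hE; rewrite -frob_trmx -[frob (_ *m _)]frob_trmx trmx_mul linearD /= trmx1.
by apply: frob_solve_le; rewrite frob_trmx.
Qed.

Lemma unitmx_1D p (E : 'M[R]_p) : frob E <= 1 / 2 -> 1%:M + E \in unitmx.
Proof.
move=> hE; rewrite -row_free_unit -kermx_eq0; apply/eqP/frob_eq0/le_anti.
rewrite frob_ge0 andbT; apply: le_trans (frob_solver_le _ hE) _.
by rewrite mulmx_ker frob0 mulr0.
Qed.

Lemma coproj_idem n r (V : 'M[R]_(n, r)) : orthonormal_cols V ->
  (1%:M - V *m V^T) *m (1%:M - V *m V^T) = 1%:M - V *m V^T.
Proof.
move=> hV; have QQ : V *m V^T *m (V *m V^T) = V *m V^T.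
  by rewrite mulmxA -(mulmxA V) hV mulmx1.
by rewrite mulmxBr mulmx1 mulmxBl mul1mx QQ subrr subr0.
Qed.

Lemma frame_coproj n r (V : 'M[R]_(n, r)) : orthonormal_cols V ->
  V^T *m (1%:M - V *m V^T) = 0.
Proof. by move=> hV; rewrite mulmxBr mulmx1 mulmxA hV mul1mx subrr. Qed.

End Perturbation.

(** A bound for |(I + E)(I - V V^T)| when |E| <= 1/2. *)
Definition graph_bound (R : realType) (n : nat) : R := frob (1%:M : 'M[R]_n) + 1.

(** A bound for the speed at which the kernel has to move. *)
Definition transport_rate (R : realType) (n : nat) (L : R) : R :=
  3 * (2 * (n%:R * graph_bound R n * L)).

Lemma graph_bound_ge0 (R : realType) n : 0 <= graph_bound R n.
Proof. by rewrite addr_ge0 ?frob_ge0. Qed.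

Lemma transport_rate_ge0 (R : realType) n (L : R) : 0 <= L -> 0 <= transport_rate n L.
Proof. by move=> L0; rewrite !mulr_ge0 ?graph_bound_ge0. Qed.

Section Transport.
Variables (R : realType) (m n r : nat).
Variables (L B eps a : R).
Hypotheses (rm : (r < m)%N) (rn : (r < n)%N) (L0 : 0 < L) (eps0 : 0 <= eps).
Hypothesis ea : eps < a.
Variable V : 'M[R]_(n, r).
Hypothesis hV : orthonormal_cols V.
Local Notation W := (1%:M - V *m V^T).
Local Notation nu := (graph_bound R n).
Local Notation c := (transport_rate n L).

Lemma frob_graph (E : 'M[R]_n) : frob E <= 1 / 2 -> frob ((1%:M + E) *m W) <= nu.
Proof.
move=> hE; apply: le_trans (frob_coprojr _ hV) _; apply: le_trans (frobD _ _) _.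
rewrite /graph_bound; lra.
Qed.

(** One Euler substep for the pair of the curve and its approximate kernel.  Put
Bm = I + E and N = Bm W with W = I - V V^T.  The matrix Y = p Bm V V^T Bm^-1 has
rank at most r, is annihilated by N exactly, and lies within 2 |p N| of p.  So
[tangent_selection] provides G with f(Y) N = Y G + O(a).  As Y G = p Gam for
Gam = Bm V V^T Bm^-1 G, subtracting tau Gam W from E cancels the first-order
growth of p N, up to O(a) and a multiple of |p N| itself. *)
Lemma kernel_transport_step (f : 'M[R]_(m, n) -> 'M[R]_(m, n))
    (p p' : 'M[R]_(m, n)) (E : 'M[R]_n) (d tau : R) :
  (forall X Z, frob (f X - f Z) <= L * frob (X - Z)) ->
  (forall y : factors R m n r, is_rank_factors y ->
    frob ((1%:M - facU y *m (facU y)^T) *m f (fmat y) *m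
        (1%:M - facV y *m (facV y)^T)) <= eps) ->
  frob (f p) <= B -> 0 <= tau ->
  frob (p' - p - tau *: f p) <= tau * d ->
  frob E + tau * c <= 1 / 2 ->
  exists E' : 'M[R]_n, frob E' <= frob E + tau * c /\
   frob (p' *m ((1%:M + E') *m W)) <=
     (1 + 2 * L * nu * tau) * frob (p *m ((1%:M + E) *m W))
     + tau * (2 * (n%:R * nu * a) + nu * d + tau * B * c).
Proof.
move=> f_lip f_tan fB tau0 pp Etau.
have nu0 : 0 <= nu := graph_bound_ge0 R n.
have c0 : 0 <= c := transport_rate_ge0 n (ltW L0).
have tc0 : 0 <= tau * c by rewrite mulr_ge0.
have hE : frob E <= 1 / 2 by lra.
have WW : W *m W = W by exact: coproj_idem.
have Bu := unitmx_1D hE.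
have Nnu := frob_graph hE.
set Bm := 1%:M + E in Bu Nnu *; set N := Bm *m W in Nnu *.
have NW : N *m W = N by rewrite -mulmxA WW.
pose Lm := (V^T *m invmx Bm)^T.
have LN : Lm^T *m N = 0.
  by rewrite trmxK -mulmxA mulKmx // frame_coproj.
have [G [hG hres]] :=
  tangent_selection rm rn L0 eps0 f_lip f_tan (p *m Bm *m V) ea LN Nnu.
set Y := p *m Bm *m V *m Lm^T in hres.
pose Gam := Bm *m (V *m V^T *m (invmx Bm *m G)).
have YG : Y *m G = p *m Gam by rewrite /Y /Gam trmxK !mulmxA.
have hGam : frob Gam <= c.
  have h1 : frob (invmx Bm *m G) <= 2 * frob G.
    by apply: le_trans (frob_solve_le _ hE) _; rewrite mulKVmx.
  have h2 := frob_proj (invmx Bm *m G) hV.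
  set X := V *m V^T *m _ in h2 *.
  have h3 : frob Gam <= frob X + 1 / 2 * frob X.
    rewrite /Gam /Bm -/X mulmxDl mul1mx; apply: le_trans (frobD _ _) _.
    by rewrite lerD2l; apply: le_trans (frobM _ _) _; rewrite ler_wpM2r ?frob_ge0.
  by rewrite /transport_rate; lra.
have hGW : frob (Gam *m W) <= c by apply: le_trans (frob_coprojr _ hV) hGam.
pose E' := E - tau *: (Gam *m W).
have hE' : frob E' <= frob E + tau * c.
  apply: le_trans (frobB _ _) _; rewrite frobZ ger0_norm //.
  by rewrite lerD2l ler_wpM2l.
exists E'; split => //.
have N'nu : frob ((1%:M + E') *m W) <= nu by apply: frob_graph; lra.
have N'E : (1%:M + E') *m W = N - tau *: (Gam *m W).
  by rewrite /E' addrA mulmxBl -scalemxAl -(mulmxA Gam) WW.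
have distY : frob (p - Y) <= 2 * frob (p *m N).
  apply: le_trans (frob_solver_le _ hE) _; rewrite -/Bm.
  have -> : (p - Y) *m Bm = p *m N; last by [].
  rewrite mulmxBl /Y trmxK -!mulmxA mulVmx // mulmx1 /N /W mulmxBr mulmx1.
  by rewrite mulmxBr.
set rho := p' - p - tau *: f p in pp.
have D'E : p' *m ((1%:M + E') *m W) = p *m N
   + tau *: ((f p - f Y) *m N + (f Y *m N - Y *m G) *m W)
   - (tau * tau) *: (f p *m (Gam *m W)) + rho *m ((1%:M + E') *m W).
  have -> : p' = p + tau *: f p + rho by apply/matrixP => i j; rewrite !mxE; ring.
  rewrite (mulmxDl (p + tau *: f p) rho); congr (_ + _).
  rewrite (mulmxBl (f Y *m N)) -(mulmxA _ N) NW YG (mulmxBl (f p)).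
  rewrite N'E mulmxBr !mulmxDl -!scalemxAl -!scalemxAr ?scalerA.
  rewrite (mulmxA p Gam).
  move: (f p *m N) (f Y *m N) (p *m Gam *m W) (f p *m (Gam *m W)) (p *m N).
  move=> X1 X2 X3 X4 X5.
  by apply/matrixP => i j; rewrite !mxE; ring.
rewrite D'E.
apply: le_trans (frobD _ _) _.
have t1 : frob (rho *m ((1%:M + E') *m W)) <= tau * d * nu.
  by apply: le_trans (frobM _ _) _; apply: ler_pM; rewrite ?frob_ge0.
have t2 : frob ((f Y *m N - Y *m G) *m W) <= 2 * (n%:R * nu * a).
  by apply: le_trans (frob_coprojr _ hV) hres.
have t3 : frob ((f p - f Y) *m N) <= L * (2 * frob (p *m N)) * nu.
  apply: le_trans (frobM _ _) _; apply: ler_pM; rewrite ?frob_ge0 //.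
  by apply: le_trans (f_lip _ _) _; rewrite ler_pM2l.
have t4 : frob (f p *m (Gam *m W)) <= B * c.
  by apply: le_trans (frobM _ _) _; apply: ler_pM; rewrite ?frob_ge0.
have t5 : frob (p *m N + tau *: ((f p - f Y) *m N + (f Y *m N - Y *m G) *m W)
   - (tau * tau) *: (f p *m (Gam *m W)))
   <= frob (p *m N) + tau * (L * (2 * frob (p *m N)) * nu + 2 * (n%:R * nu * a))
      + tau * tau * (B * c).
  apply: le_trans (frobB _ _) _; rewrite frobZ ger0_norm ?mulr_ge0 //.
  apply: lerD; last by rewrite ler_wpM2l ?mulr_ge0.
  apply: le_trans (frobD _ _) _; rewrite lerD2l frobZ ger0_norm //.
  rewrite ler_wpM2l //; apply: le_trans (frobD _ _) _; exact: lerD.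
apply: le_trans (lerD t5 t1) _.
by rewrite le_eqVlt; apply/orP; left; apply/eqP; ring.
Qed.

(** Discrete Gronwall argument for [kernel_transport_step]; over K tau c <= 1/2
the growth factors multiply to at most 2. *)
Lemma kernel_transport (f : nat -> 'M[R]_(m, n) -> 'M[R]_(m, n))
    (p : nat -> 'M[R]_(m, n)) (d tau : R) (K : nat) :
  (forall j X Z, (j < K)%N -> frob (f j X - f j Z) <= L * frob (X - Z)) ->
  (forall j (y : factors R m n r), (j < K)%N -> is_rank_factors y ->
    frob ((1%:M - facU y *m (facU y)^T) *m f j (fmat y) *m
        (1%:M - facV y *m (facV y)^T)) <= eps) ->
  (forall j X, (j < K)%N -> frob (f j X) <= B) -> 0 <= tau -> 0 <= d ->
  p 0%N *m W = 0 ->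
  (forall j, (j < K)%N -> frob (p j.+1 - p j - tau *: f j (p j)) <= tau * d) ->
  K%:R * tau * c <= 1 / 2 ->
  exists E : 'M[R]_n, frob E <= 1 / 2 /\
    frob (p K *m ((1%:M + E) *m W)) <=
      2 * (K%:R * tau) * (2 * (n%:R * nu * a) + nu * d + tau * B * c).
Proof.
move=> f_lip f_tan fB tau0 d0 p0 pp hK.
have nu0 : 0 <= nu := graph_bound_ge0 R n.
have c0 : 0 <= c := transport_rate_ge0 n (ltW L0).
set g := 2 * (n%:R * nu * a) + nu * d + tau * B * c.
have a0 : 0 <= a by rewrite ltW // (le_lt_trans eps0).
have n1 : 1 <= n%:R :> R by rewrite ler1n (leq_ltn_trans _ rn).
have [K0|Kp] := posnP K.
  exists 0; rewrite frob0; split; first by rewrite divr_ge0.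
  by rewrite K0 addr0 mul1mx p0 frob0 mul0r mulr0 mul0r.
have B0 : 0 <= B by apply: le_trans (fB 0%N 0 Kp); exact: frob_ge0.
have g0 : 0 <= g.
  have h1 : 0 <= n%:R * nu * a := mulr_ge0 (mulr_ge0 (ler0n R n) nu0) a0.
  have h2 : 0 <= tau * B * c := mulr_ge0 (mulr_ge0 tau0 B0) c0.
  by have h3 : 0 <= nu * d := mulr_ge0 nu0 d0; rewrite /g; lra.
have Lnu : 6 * (L * nu) <= c.
  have : L * nu <= n%:R * (L * nu) by rewrite ler_peMl // mulr_ge0 // ltW.
  by rewrite /transport_rate -mulrA (mulrC nu); lra.
suff [E [hE hD]] : exists E : 'M[R]_n, frob E <= K%:R * tau * c /\
    frob (p K *m ((1%:M + E) *m W)) <= 2 * (K%:R * tau) * g.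
  by exists E; split => //; exact: le_trans hK.
elim: {-2}K (leqnn K) => [_|j IH jK].
  exists 0; rewrite frob0 !mul0r mulr0 mul0r; split => //.
  by rewrite addr0 mul1mx p0 frob0.
have [E [hE hD]] := IH (ltnW jK).
have step_le : j.+1%:R * tau * c <= 1 / 2.
  by apply: le_trans hK; rewrite ler_wpM2r // ler_wpM2r // ler_nat.
have jS : j.+1%:R * tau * c = j%:R * tau * c + tau * c by rewrite -natr1; ring.
have [|E' [hE' hD']] := kernel_transport_step (fun X Z => f_lip j X Z jK)
  (fun y => f_tan j y jK) (fB j (p j) jK) tau0 (pp j jK) (E := E).
  by move: step_le; rewrite jS; lra.
exists E'; split; first by rewrite jS; lra.
apply: le_trans hD' _; rewrite -/g.
have x0 : 0 <= j%:R * tau :> R by rewrite mulr_ge0.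
have small : 4 * (L * nu) * (j%:R * tau) <= 1.
  have h : j%:R * tau * (6 * (L * nu)) <= j%:R * tau * c by rewrite ler_wpM2l.
  have h' : j%:R * tau * c <= 1 / 2.
    apply: le_trans step_le; rewrite jS lerDl; exact: mulr_ge0.
  have : 0 <= j%:R * tau * (L * nu) by rewrite !mulr_ge0 // ltW.
  by move: h h'; lra.
have LN0 : 0 <= 2 * L * nu * tau by rewrite !mulr_ge0 // ltW.
have h1 : (1 + 2 * L * nu * tau) * frob (p j *m ((1%:M + E) *m W))
    <= (1 + 2 * L * nu * tau) * (2 * (j%:R * tau) * g).
  by rewrite ler_wpM2l // addr_ge0.
have h2 : tau * g * (4 * (L * nu) * (j%:R * tau)) <= tau * g * 1.
  by rewrite ler_wpM2l ?mulr_ge0.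
have -> : 2 * (j.+1%:R * tau) * g = 2 * (j%:R * tau) * g + 2 * (tau * g).
  by rewrite -natr1; ring.
move: h1 h2; lra.
Qed.

End Transport.

(** * The error of one K-L step *)


Section KL.
Variables (R : realType) (m n r : nat).
Implicit Types (y : factors R m n r).

Lemma KL_step_projects y0 y1 (dA : 'M[R]_(m, n)) :
  orthonormal_cols (facV y0) -> KL_step y0 dA y1 ->
  fmat y1 = facU y1 *m (facU y1)^T *m (fmat y0 + dA) /\
  (1%:M - facU y1 *m (facU y1)^T) *m (fmat y0 + dA) *m facV y0 = 0.
Proof.
case: y0 y1 => U0 S0 V0 [U1 S1 V1] /= hV0.
rewrite /KL_step /KL_K /KL_L /fmat /= => -[hU1 [Sh KE] hV1 LE].
have SV : S1 *m V1^T = U1^T *m (U0 *m S0 *m V0^T + dA).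
  apply: trmx_inj; rewrite trmx_mul trmxK LE trmx_mul trmxK -mulmxDl.
  by rewrite linearD /= !trmx_mul trmxK !mulmxA.
split; first by rewrite -(mulmxA U1) SV mulmxA.
rewrite -mulmxA (mulmxDl (U0 *m S0 *m V0^T)) -(mulmxA (U0 *m S0)) hV0.
rewrite mulmx1 -KE mulmxA.
by rewrite mulmxBl mul1mx -(mulmxA U1) hU1 mulmx1 subrr mul0mx.
Qed.

(** The core of the output multiplies V_1^T V_n to the core of K_1, which has
rank r. *)
Lemma KL_step_rank y0 y1 (dA : 'M[R]_(m, n)) :
  orthonormal_cols (facV y0) -> KL_step y0 dA y1 -> KL_admissible y0 dA ->
  is_rank_factors y1.
Proof.
move=> hV0 st; move: hV0 st (KL_step_projects hV0 st).
case: y0 y1 => U0 S0 V0 [U1 S1 V1] /= hV0.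
rewrite /KL_step /KL_admissible /KL_K /KL_L /fmat /=.
move=> [hU1 [Sh KE] hV1 LE] [Y1E _] rk; split => //=.
rewrite -row_free_unit /row_free eqn_leq rank_leq_row /= -{1}rk.
have -> : U0 *m S0 + dA *m V0 = U1 *m (S1 *m (V1^T *m V0)).
  have E : U0 *m S0 + dA *m V0 = (U0 *m S0 *m V0^T + dA) *m V0.
    by rewrite mulmxDl -(mulmxA (U0 *m S0)) hV0 mulmx1.
  have E2 : U1 *m U1^T *m (U0 *m S0 + dA *m V0) = U0 *m S0 + dA *m V0.
    by rewrite -KE mulmxA -(mulmxA U1) hU1 mulmx1.
  by rewrite -E2 {1}E mulmxA -Y1E !mulmxA.
exact: leq_trans (mxrankM_maxr _ _) (mxrankM_maxl _ _).
Qed.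

(** For X = (I - P) p, with P the projector onto the new column space and Q the one
onto the old row space, X Q = (I - P)(p - W) Q because P fixes W V_n, and
X (I - Q) = X N - X E (I - Q) for N = (I + E)(I - Q).  Since |E| <= 1/2, the last
term is absorbed, and |X| <= 2 (|W - p| + |p N|). *)
Lemma KL_step_error y0 y1 (dA p : 'M[R]_(m, n)) (E : 'M[R]_n) :
  orthonormal_cols (facV y0) -> KL_step y0 dA y1 -> frob E <= 1 / 2 ->
  frob (fmat y1 - (fmat y0 + dA)) <= 3 * frob (fmat y0 + dA - p)
    + 2 * frob (p *m ((1%:M + E) *m (1%:M - facV y0 *m (facV y0)^T))).
Proof.
move=> hV0 st hE; have hU1 : orthonormal_cols (facU y1) by case: st.
have [Y1E WV] := KL_step_projects hV0 st.
move: (fmat y0 + dA) Y1E WV => W -> WV.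
set V := facV y0 in hV0 WV *; set U := facU y1 in hU1 WV *.
set N := _ *m (1%:M - _); set P' := 1%:M - U *m U^T in WV *.
have -> : U *m U^T *m W - W = - (P' *m W).
  by rewrite /P' mulmxBl mul1mx opprB.
rewrite frobN.
pose X := P' *m p.
have e1 : frob (P' *m W) <= frob (W - p) + frob X.
  have -> : P' *m W = P' *m (W - p) + X by rewrite mulmxBr subrK.
  by apply: le_trans (frobD _ _) _; rewrite lerD2r frob_coproj.
have e2 : frob (X *m (V *m V^T)) <= frob (W - p).
  have -> : X *m (V *m V^T) = - (P' *m (W - p) *m (V *m V^T)).
    by rewrite mulmxBr mulmxBl mulmxA (mulmxA _ V) WV mul0mx sub0r opprK.
  by rewrite frobN; apply: le_trans (frob_projr _ hV0) _; rewrite frob_coproj.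
have e3 : frob (X *m N) <= frob (p *m N) by rewrite -mulmxA frob_coproj.
have e4 : frob (X *m E *m (1%:M - V *m V^T)) <= 1 / 2 * frob X.
  apply: le_trans (frob_coprojr _ hV0) _; apply: le_trans (frobM _ _) _.
  by rewrite mulrC ler_wpM2r ?frob_ge0.
have e5 : frob X <= frob (X *m (V *m V^T)) + (frob (X *m N)
    + frob (X *m E *m (1%:M - V *m V^T))).
  have XE : X = X *m (V *m V^T) + (X *m N - X *m E *m (1%:M - V *m V^T)).
    rewrite /N mulmxA (mulmxDr X) mulmx1 (mulmxDl X) addrK mulmxBr mulmx1.
    by rewrite addrC subrK.
  rewrite {1}XE; apply: le_trans (frobD _ _) _; apply: lerD => //.
  exact: frobB.
lra.
Qed.

End KL.

(** * One-sided derivatives and Taylor estimates *)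


(** The derivative of f at t relative to the interval with end points a and b,
one-sided at these end points, as an estimate in the Frobenius norm. *)
Definition deriv_in (R : realType) (m n : nat) (a b : R) (f : R -> 'M[R]_(m, n))
    (t : R) (l : 'M[R]_(m, n)) : Prop :=
  forall e : R, 0 < e -> exists2 d : R, 0 < d &
    forall s, a <= s <= b -> `|s - t| < d ->
      frob (f s - f t - (s - t) *: l) <= e * `|s - t|.

Definition cubic (R : realType) (m n : nat) (c0 c1 c2 c3 : 'M[R]_(m, n)) (s : R)
    : 'M[R]_(m, n) :=
  c0 + s *: c1 + (s ^+ 2 / 2) *: c2 + (s ^+ 3 / 6) *: c3.

Section Calculus.
Variables (R : realType) (m n : nat).
Implicit Types (f g : R -> 'M[R]_(m, n)).

Lemma frob_le_entries (X : 'M[R]_(m, n)) (e : R) :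
  (forall i j, `|X i j| <= e) -> 0 <= e -> frob X <= (m * n)%:R * e.
Proof.
move=> H e0; apply: frob_le_sqr; first by rewrite mulr_ge0.
apply: (@le_trans _ _ (\sum_(i < m) \sum_(j < n) e ^+ 2)).
  apply: ler_sum => i _; apply: ler_sum => j _.
  rewrite -expr2 -[leLHS]real_normK ?num_real // ler_pXn2r ?nnegrE //.
rewrite !sumr_const !card_ord -mulrnA -[leLHS]mulr_natl exprMn ler_wpM2r ?sqr_ge0 //.
by rewrite -natrX ler_nat mulnC; case: (m * n)%N => // k; rewrite leq_pmulr.
Qed.

Lemma entry_le_norm (X : 'M[R]_(m, n)) i j : `|X i j| <= `|X|.
Proof.
rewrite -[leRHS]/(mx_norm X) mx_normrE.
exact: (le_bigmax _ (fun ij : 'I_m * 'I_n => `|X ij.1 ij.2|) (i, j)).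
Qed.

Lemma deriv_in_diff_quot a b f t l :
  (forall e : R, 0 < e -> exists2 d : R, 0 < d &
    forall s, a <= s <= b -> s != t -> `|s - t| < d ->
      forall i j, `|(diff_quot f t s - l) i j| <= e) ->
  deriv_in a b f t l.
Proof.
move=> H e e0; have c0 : 0 < ((m * n)%:R + 1) :> R by rewrite ltr_wpDl.
have [d d0 hd] := H _ (divr_gt0 e0 c0); exists d => // s sab sd.
have [->|st] := eqVneq s t.
  by rewrite !subrr scale0r subr0 frob0 normr0 mulr0.
have := hd s sab st sd; move=> /frob_le_entries /(_ (ltW (divr_gt0 e0 c0))) h.
have st0 : s - t != 0 by rewrite subr_eq0.
have -> : f s - f t - (s - t) *: l = (s - t) *: (diff_quot f t s - l).
  by rewrite scalerBr /diff_quot scalerA mulfV // scale1r.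
rewrite frobZ mulrC; apply: ler_wpM2r => //; apply: le_trans h _.
by rewrite mulrCA ler_piMr ?(ltW e0) // ler_pdivrMr // mul1r lerDl ler01.
Qed.

Lemma deriv_in_has_deriv a b f t l :
  has_deriv_on `[a, b] f t l -> deriv_in a b f t l.
Proof.
move=> H; apply: deriv_in_diff_quot => e e0.
have /cvgrPdist_le/(_ e e0) := H; rewrite near_withinE near_withinE.
move=> /nbhs_ballP[d /= d0 hd]; exists d => // s sab st sd i j.
have ts : ball t d s by rewrite /ball /= distrC.
have sI : `[a, b]%classic s by rewrite /= in_itv.
have := hd s ts st sI; rewrite distrC; apply: le_trans; exact: entry_le_norm.
Qed.

Lemma deriv_in_line (G : 'M[R]_(m, n) -> 'M[R]_(m, n)) a b (Z e : 'M[R]_(m, n)) t :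
  differentiable G (Z + t *: e) ->
  deriv_in a b (fun s => G (Z + s *: e)) t ('d G (Z + t *: e) e).
Proof.
move=> dG; apply: deriv_in_diff_quot => q q0.
have lim_quot : h^-1 *: ((G \o shift (Z + t *: e)) (h *: e) - G (Z + t *: e))
    @[h --> 0^'] --> 'd G (Z + t *: e) e.
  by rewrite -deriveE //; exact: (@diff_derivable _ _ _ _ _ e dG).
have /cvgrPdist_le/(_ q q0) := lim_quot; rewrite near_withinE.
move=> /nbhs_ballP[d /= d0 hd]; exists d => // s _ st sd i j.
have st0 : s - t != 0 by rewrite subr_eq0.
have b0 : ball 0 d (s - t) by rewrite /ball /= sub0r normrN.
have := hd _ b0 st0; rewrite /= distrC /diff_quot.
have -> : (s - t) *: e + (Z + t *: e) = Z + s *: e.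
  by rewrite addrCA -scalerDl subrK.
apply: le_trans; exact: entry_le_norm.
Qed.

Lemma deriv_in_sub a b a' b' f t l :
  a <= a' -> b' <= b -> deriv_in a b f t l -> deriv_in a' b' f t l.
Proof.
move=> aa bb H e e0; have [d d0 hd] := H e e0; exists d => // s /andP[s1 s2].
by apply: hd; rewrite (le_trans aa s1) (le_trans s2 bb).
Qed.

Lemma deriv_in_shift a b f t l c :
  deriv_in (c + a) (c + b) f (c + t) l -> deriv_in a b (fun s => f (c + s)) t l.
Proof.
move=> H e e0; have [d d0 hd] := H e e0; exists d => // s sab.
have E : c + s - (c + t) = s - t by ring.
by have := hd (c + s); rewrite !lerD2l E; apply.
Qed.

Lemma deriv_inB a b f g t l k :
  deriv_in a b f t l -> deriv_in a b g t k ->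
  deriv_in a b (fun s => f s - g s) t (l - k).
Proof.
move=> hf hg e e0; have e2 : 0 < e / 2 by rewrite divr_gt0.
have [d1 d10 h1] := hf _ e2; have [d2 d20 h2] := hg _ e2.
exists (Num.min d1 d2); first by rewrite lt_min d10.
move=> s sab; rewrite lt_min => /andP[s1 s2].
have -> : f s - g s - (f t - g t) - (s - t) *: (l - k) =
  (f s - f t - (s - t) *: l) - (g s - g t - (s - t) *: k).
  by apply/matrixP => i j; rewrite !mxE; ring.
apply: le_trans (frobB _ _) _; have := h1 s sab s1; have := h2 s sab s2; lra.
Qed.

Lemma deriv_in_cubic a b (c0 c1 c2 c3 : 'M[R]_(m, n)) t :
  deriv_in a b (cubic c0 c1 c2 c3) t (c1 + t *: c2 + (t ^+ 2 / 2) *: c3).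
Proof.
move=> e e0; pose K := frob c2 + (3 * `|t| + 1) * frob c3.
have K0 : 0 <= K.
  by rewrite /K addr_ge0 ?frob_ge0 // mulr_ge0 ?frob_ge0 // addr_ge0 // mulr_ge0.
have K1 : 0 < K + 1 by rewrite ltr_wpDl.
exists (Num.min 1 (e / (K + 1))); first by rewrite lt_min ltr01 divr_gt0.
move=> s _; rewrite lt_min => /andP[s1 s2].
have -> : cubic c0 c1 c2 c3 s - cubic c0 c1 c2 c3 t
    - (s - t) *: (c1 + t *: c2 + (t ^+ 2 / 2) *: c3)
  = (s - t) ^+ 2 *: ((1 / 2) *: c2 + ((s + 2 * t) / 6) *: c3).
  by apply/matrixP => i j; rewrite !mxE; field.
rewrite frobZ ger0_norm ?sqr_ge0 // -[_ ^+ 2]real_normK ?num_real // expr2.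
rewrite -mulrA [leLHS]mulrC; apply: ler_wpM2r => //.
have hK : frob ((1 / 2) *: c2 + ((s + 2 * t) / 6) *: c3) <= K.
  apply: le_trans (frobD _ _) _; rewrite !frobZ; apply: lerD.
    by rewrite ger0_norm //; have := frob_ge0 c2; lra.
  apply: ler_wpM2r; first exact: frob_ge0.
  rewrite normrM [`|6^-1|]ger0_norm //.
  have : `|s + 2 * t| <= `|s - t| + 3 * `|t|.
    have -> : s + 2 * t = (s - t) + 3 * t by ring.
    by apply: le_trans (ler_normD _ _) _; rewrite normrM [`|3|]ger0_norm.
  by have := normr_ge0 t; lra.
apply: (@le_trans _ _ (`|s - t| * K)); first by rewrite ler_wpM2l.
move: s2; rewrite ltr_pdivlMr // mulrDr mulr1.
by have := normr_ge0 (s - t); lra.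
Qed.

(** The scalar mean value theorem for s |-> <W, f s>. *)
Lemma mean_value_dot (W : 'M[R]_(m, n)) a b f f' (c : R) : a < b ->
  (forall t, a <= t <= b -> deriv_in a b f t (f' t)) ->
  (forall t, a <= t <= b -> frob (f' t) <= c) ->
  dot W (f b - f a) <= c * (b - a) * frob W.
Proof.
move=> ab H hc; pose phi s := dot W (f s).
have est e t : 0 < e -> a <= t <= b -> exists2 d, 0 < d &
    forall s, a <= s <= b -> `|s - t| < d ->
      `|phi s - phi t - (s - t) * dot W (f' t)| <= e * `|s - t|.
  move=> e0 tab; have w0 : 0 < frob W + 1 by rewrite ltr_wpDl ?frob_ge0.
  have [d d0 hd] := H t tab _ (divr_gt0 e0 w0); exists d => // s sab sd.
  rewrite /phi -dotZr -!dotBr; apply: le_trans (dot_norm_le _ _) _.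
  have h := hd s sab sd.
  apply: (@le_trans _ _ (frob W * (e / (frob W + 1) * `|s - t|))).
    by rewrite ler_wpM2l ?frob_ge0.
  rewrite mulrA ler_wpM2r // mulrCA ler_piMr ?(ltW e0) //.
  by rewrite ler_pdivrMr // mul1r lerDl ler01.
have der t : t \in `]a, b[%R -> is_derive t (1 : R) phi (dot W (f' t)).
  rewrite in_itv /= => /andP[ta tb].
  have tab : a <= t <= b by rewrite !ltW.
  have cv : h^-1 *: ((phi \o shift t) (h *: (1 : R)) - phi t) @[h --> 0^']
      --> dot W (f' t).
    apply/cvgrPdist_le => e e0; rewrite near_withinE.
    have [d d0 hd] := est e t e0 tab.
    apply/nbhs_ballP; exists (Num.min d (Num.min (t - a) (b - t))) => /=.
      by rewrite !lt_min d0 !subr_gt0 ta tb.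
    move=> h; rewrite /ball /= sub0r normrN !lt_min => /and3P[h1 h2 h3] h0.
    have sab : a <= h + t <= b.
      by move: h2 h3; rewrite !ltr_norml => /andP[u1 u2] /andP[u3 u4]; lra.
    have := hd (h + t) sab; rewrite addrK => /(_ h1).
    have -> : h *: (1 : R) = h by rewrite /GRing.scale /= mulr1.
    rewrite -(@ler_pM2l _ `|h|^-1) ?invr_gt0 ?normr_gt0 //.
    rewrite mulrCA mulVf ?normr_eq0 // mulr1 -normfV -normrM distrC.
    by rewrite mulrBr mulKf.
  apply: DeriveDef; first exact: cvgP cv.
  exact: cvg_lim cv.
have cont : {within `[a, b], continuous phi}.
  apply/subspace_continuousP => t; rewrite /= in_itv /= => tab.
  apply/cvgrPdist_le => e e0; rewrite near_withinE.
  have [d d0 hd] := est 1 t ltr01 tab.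
  pose K := 1 + `|dot W (f' t)|; have K0 : 0 < K by rewrite ltr_wpDr.
  apply/nbhs_ballP; exists (Num.min d (e / K)) => /=.
    by rewrite lt_min d0 divr_gt0.
  move=> s; rewrite /ball /= distrC lt_min => /andP[s1 s2]; rewrite in_itv /= => sab.
  have := hd s sab s1; rewrite mul1r => h.
  have h2 : `|phi s - phi t| <= `|s - t| + `|s - t| * `|dot W (f' t)|.
    rewrite -normrM.
    have -> : phi s - phi t = phi s - phi t - (s - t) * dot W (f' t)
        + (s - t) * dot W (f' t) by rewrite subrK.
    by apply: le_trans (ler_normD _ _) _; rewrite lerD2r.
  rewrite distrC; apply: le_trans h2 _.
  by move: s2; rewrite ltr_pdivlMr // /K mulrDr mulr1 => /ltW.
have [x xab E] := MVT ab der cont.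
rewrite dotBr -/(phi b) -/(phi a) E.
have {}xab : a <= x <= b.
  by move: xab; rewrite in_itv /= => /andP[/ltW -> /ltW ->].
rewrite mulrAC; apply: ler_wpM2r; first by rewrite subr_ge0 ltW.
apply: le_trans (dot_le _ _) _; rewrite mulrC ler_wpM2r ?frob_ge0 //.
exact: hc.
Qed.

Lemma mean_value a b f f' (c : R) : a <= b ->
  (forall t, a <= t <= b -> deriv_in a b f t (f' t)) ->
  (forall t, a <= t <= b -> frob (f' t) <= c) ->
  frob (f b - f a) <= c * (b - a).
Proof.
rewrite le_eqVlt => /orP[/eqP ->|ab] H hc.
  by rewrite !subrr frob0 mulr0.
have c0 : 0 <= c.
  by apply: le_trans (frob_ge0 (f' a)) (hc a _); rewrite lexx ltW.
apply: frob_dual; first by rewrite mulr_ge0 // subr_ge0 ltW.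
by move=> W; exact: mean_value_dot H hc.
Qed.

Lemma taylor1 b f f1 (c : R) : 0 <= b ->
  (forall t, 0 <= t <= b -> deriv_in 0 b f t (f1 t)) ->
  (forall t, 0 <= t <= b -> frob (f1 t) <= c) ->
  frob (f b - f 0) <= c * b.
Proof. by move=> b0 H hc; have := mean_value b0 H hc; rewrite subr0. Qed.

Lemma taylor2 b f f1 f2 (c : R) : 0 <= b ->
  (forall t, 0 <= t <= b -> deriv_in 0 b f t (f1 t)) ->
  (forall t, 0 <= t <= b -> deriv_in 0 b f1 t (f2 t)) ->
  (forall t, 0 <= t <= b -> frob (f2 t) <= c) ->
  frob (f b - f 0 - b *: f1 0) <= c * b ^+ 2.
Proof.
move=> b0 H H1 hc.
have c0 : 0 <= c by apply: le_trans (frob_ge0 (f2 0)) (hc 0 _); rewrite lexx.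
pose q := cubic (f 0) (f1 0) 0 0.
have := @mean_value 0 b (fun s => f s - q s)
  (fun t => f1 t - (f1 0 + t *: 0 + (t ^+ 2 / 2) *: 0)) (c * b) b0.
have -> : f b - q b - (f 0 - q 0) = f b - f 0 - b *: f1 0.
  by apply/matrixP => i j; rewrite !mxE; ring.
rewrite subr0 -mulrA -expr2; apply.
  move=> t tb; apply: deriv_inB; first exact: H.
  exact: deriv_in_cubic.
move=> t /andP[t0 tb]; rewrite !scaler0 !addr0.
have := @taylor1 t f1 f2 c t0; move/(_ _ _)/le_trans; apply.
- move=> s /andP[s0 st]; apply: (deriv_in_sub (lexx 0) tb).
  by apply: H1; rewrite s0 (le_trans st).
- by move=> s /andP[s0 st]; apply: hc; rewrite s0 (le_trans st).
- by rewrite ler_wpM2l.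
Qed.

Lemma taylor3 b f f1 f2 f3 (c : R) : 0 <= b ->
  (forall t, 0 <= t <= b -> deriv_in 0 b f t (f1 t)) ->
  (forall t, 0 <= t <= b -> deriv_in 0 b f1 t (f2 t)) ->
  (forall t, 0 <= t <= b -> deriv_in 0 b f2 t (f3 t)) ->
  (forall t, 0 <= t <= b -> frob (f3 t) <= c) ->
  frob (f b - f 0 - b *: f1 0 - (b ^+ 2 / 2) *: f2 0) <= c * b ^+ 3.
Proof.
move=> b0 H H1 H2 hc.
have c0 : 0 <= c by apply: le_trans (frob_ge0 (f3 0)) (hc 0 _); rewrite lexx.
pose q := cubic (f 0) (f1 0) (f2 0) 0.
have := @mean_value 0 b (fun s => f s - q s)
  (fun t => f1 t - (f1 0 + t *: f2 0 + (t ^+ 2 / 2) *: 0)) (c * b ^+ 2) b0.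
have -> : f b - q b - (f 0 - q 0) = f b - f 0 - b *: f1 0 - (b ^+ 2 / 2) *: f2 0.
  by apply/matrixP => i j; rewrite !mxE; ring.
rewrite subr0 -mulrA -exprSr; apply.
  move=> t tb; apply: deriv_inB; first exact: H.
  exact: deriv_in_cubic.
move=> t /andP[t0 tb]; rewrite scaler0 addr0 opprD addrA.
have := @taylor2 t f1 f2 f3 c t0; move/(_ _ _ _)/le_trans; apply.
- move=> s /andP[s0 st]; apply: (deriv_in_sub (lexx 0) tb).
  by apply: H1; rewrite s0 (le_trans st).
- move=> s /andP[s0 st]; apply: (deriv_in_sub (lexx 0) tb).
  by apply: H2; rewrite s0 (le_trans st).
- by move=> s /andP[s0 st]; apply: hc; rewrite s0 (le_trans st).
- by rewrite ler_wpM2l // ler_pXn2r ?nnegrE.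
Qed.

End Calculus.

(** * The model curve *)


(** The function [dt_dX] with its directions given as a list, so that directions
can be added one at a time. *)
Definition partial (R : realType) (m n : nat) (T : R)
    (F : R -> 'M[R]_(m, n) -> 'M[R]_(m, n)) (a : nat) (Hs : seq 'M[R]_(m, n))
    (X : 'M[R]_(m, n)) (t : R) : 'M[R]_(m, n) :=
  iter a (derive_on `[0, T]) (fun s => dX (F s) Hs X) t.

Section Partials.
Variables (R : realType) (m n : nat) (T : R).
Implicit Types (F : R -> 'M[R]_(m, n) -> 'M[R]_(m, n)).

Lemma class_C_dX F Hs k : class_C T (size Hs + k) F ->
  class_C T k (fun t X => dX (F t) Hs X).
Proof.
elim: Hs k => [|H Hs IH] k; first by [].
by rewrite [size _]/= addSnnS => /IH [_ [_ _ h]]; exact: h.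
Qed.

Lemma class_C_partial F a Hs k : class_C T (a + size Hs + k) F ->
  class_C T k (fun t X => partial T F a Hs X t).
Proof.
elim: a k => [|a IH] k; first exact: class_C_dX.
by rewrite !addSn -addnS => /IH [_ [_ h _]]; exact: h.
Qed.

Variables (F : R -> 'M[R]_(m, n) -> 'M[R]_(m, n)) (M : R).
Hypotheses (CF : class_C T 3 F) (bF : bounded_partials T 3 M F).

Lemma partial_time_deriv a Hs X t h s : (a + size Hs <= 2)%N ->
  0 <= t -> t + h <= T -> 0 <= s <= h ->
  deriv_in 0 h (fun s => partial T F a Hs X (t + s)) s (partial T F a.+1 Hs X (t + s)).
Proof.
move=> ah t0 th /andP[s0 sh]; apply: deriv_in_shift.
apply: (@deriv_in_sub _ _ _ 0 T); rewrite ?addr0 //.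
have tT : 0 <= t + s <= T by rewrite addr_ge0 //= (le_trans _ th) // lerD2l.
have : class_C T (2 - (a + size Hs)).+1 (fun t X => partial T F a Hs X t).
  by apply: class_C_partial; rewrite addnS subnKC.
move=> [_ [/(_ (t + s) X tT) [[l hl] _] _ _]].
by apply: deriv_in_has_deriv; exact: (cvgP l hl).
Qed.

Lemma partial_line_deriv Hs (Z e : 'M[R]_(m, n)) t b s : (size Hs <= 2)%N ->
  0 <= t <= T ->
  deriv_in 0 b (fun s => partial T F 0 Hs (Z + s *: e) t) s
    (partial T F 0 (e :: Hs) (Z + s *: e) t).
Proof.
move=> ah tT; apply: deriv_in_line.
have : class_C T (2 - size Hs).+1 (fun t X => partial T F 0 Hs X t).
  by apply: class_C_partial; rewrite addnS subnKC.
by move=> [_ [/(_ t (Z + s *: e) tT) [_ h] _ _]].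
Qed.

(** The directions are normalized because [opnorm] is a supremum over the unit ball. *)
Lemma partial_bound a Hs X t : (1 <= a + size Hs <= 3)%N -> 0 <= t <= T ->
  {in Hs, forall H, frob H <= 1} -> frob (partial T F a Hs X t) <= M.
Proof.
move=> ah tT hH; rewrite -lee_fin; apply: le_trans (bF X ah tT).
apply: ereal_sup_ubound => /=; exists (in_tuple Hs) => // i.
by apply: hH; exact: mem_tnth.
Qed.

End Partials.

(** Bounds for the coefficients of s^2/2 and s^3/6 in the model curve, and for the
constant of its defect. *)
Definition curve_bound2 (R : realType) (B M : R) : R := (1 + B) * M.

Definition curve_bound3 (R : realType) (B M : R) : R :=
  (1 + 2 * B + B ^+ 2 + curve_bound2 B M) * M.

Definition curve_defect (R : realType) (B L M : R) : R :=
  let g2 := curve_bound2 B M in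
  M * (1 + B + B ^+ 2 + B ^+ 3 + g2 + g2 ^+ 2 + B * g2) + L * curve_bound3 B M.

Lemma curve_bound2_gt0 (R : realType) (B M : R) :
  0 < B -> 0 < M -> 0 < curve_bound2 B M.
Proof. by move=> B0 M0; rewrite mulr_gt0 // addr_gt0. Qed.

Lemma curve_bound3_gt0 (R : realType) (B M : R) :
  0 < B -> 0 < M -> 0 < curve_bound3 B M.
Proof.
move=> B0 M0; have g20 := curve_bound2_gt0 B0 M0.
by have BB := exprn_gt0 2 B0; apply: mulr_gt0 => //; lra.
Qed.

Lemma curve_defect_gt0 (R : realType) (B L M : R) :
  0 < B -> 0 < L -> 0 < M -> 0 < curve_defect B L M.
Proof.
move=> B0 L0 M0; have g20 := curve_bound2_gt0 B0 M0.
have g30 := curve_bound3_gt0 B0 M0.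
by rewrite /curve_defect !(addr_gt0, mulr_gt0) ?exprn_gt0.
Qed.

Lemma curve_defect_sum (R : realType) (B L M s : R) :
  0 < B -> 0 < L -> 0 < M -> 0 <= s ->
  let g2 := curve_bound2 B M in let g3 := curve_bound3 B M in
  L * g3 * s ^+ 3 / 6 + M * g2 ^+ 2 * s ^+ 3 + M * (B * g2) * s ^+ 3 / 2
    + M * g2 * s ^+ 3 / 2 + M * B ^+ 3 * s ^+ 3 + M * B * s ^+ 3
    + M * B ^+ 2 * s ^+ 3 / 2 + M * s ^+ 3
  <= curve_defect B L M * s ^+ 3.
Proof.
move=> B0 L0 M0 s0 /=; have g20 := curve_bound2_gt0 B0 M0.
have g30 := curve_bound3_gt0 B0 M0; rewrite /curve_defect.
move: (curve_bound2 B M) (curve_bound3 B M) g20 g30 => g2 g3 g20 g30.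
have s3 : 0 <= s ^+ 3 by rewrite exprn_ge0.
have p1 : 0 <= M * (B * g2) * s ^+ 3 by rewrite !mulr_ge0 // ltW.
have p2 : 0 <= M * g2 * s ^+ 3 by rewrite !mulr_ge0 // ltW.
have p3 : 0 <= M * B ^+ 2 * s ^+ 3 by rewrite !mulr_ge0 ?sqr_ge0 // ltW.
have p4 : 0 <= L * g3 * s ^+ 3 by rewrite !mulr_ge0 // ltW.
lra.
Qed.

Section Model.
Variables (R : realType) (m n : nat) (T B L M : R).
Hypotheses (B0 : 0 < B) (L0 : 0 < L) (M0 : 0 < M).
Variable (F : R -> 'M[R]_(m, n) -> 'M[R]_(m, n)).
Hypotheses (CF : class_C T 3 F) (bF : bounded_partials T 3 M F).
Hypothesis F_bound : forall t X, 0 <= t <= T -> frob (F t X) <= B.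
Hypothesis F_lip : forall t X Z, 0 <= t <= T ->
  frob (F t X - F t Z) <= L * frob (X - Z).

Local Notation g2 := (curve_bound2 B M).
Local Notation g3 := (curve_bound3 B M).
Local Notation C := (curve_defect B L M).

Lemma frob_unit_scale (X : 'M[R]_(m, n)) (c : R) : 0 < c -> frob X <= c ->
  frob (c^-1 *: X) <= 1 /\ X = c *: (c^-1 *: X).
Proof.
move=> c0 h; split; last by rewrite scalerA mulfV ?scale1r // gt_eqF.
by rewrite frobZ ger0_norm ?invr_ge0 ?(ltW c0) // ler_pdivrMl // mulr1.
Qed.

(** The defect of the model curve as a sum of Taylor remainders.  Fp is F at the
curve; P5, P4 and P3 are F at time t + s at the points Z + rho e2, Z = Y0 + sg e
and Y0; P0, P1 and P2 are F and its first two time derivatives at (t, Y0).  T1,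
T2 and T11 are the X-derivatives at (t, Y0) along e, along e2 and twice along e,
and U1 is the time derivative of T1; S1, S2 and S11 are the values of T1, T2 and
T11 at time t + s, and Z2 is the derivative along e2 at (t + s, Z). *)
Lemma telescope_model (s g : R) (Fp P5 P4 P3 P0 P1 P2 Z2 S2 T2 S1 T1 U1 S11 T11 :
    'M[R]_(m, n)) :
  let sg := s * B in let rho := s ^+ 2 * g / 2 in
  Fp - (P0 + s *: (P1 + B *: T1)
     + (s ^+ 2 / 2) *: (P2 + (2 * B) *: U1 + B ^+ 2 *: T11 + g *: T2)) =
  (Fp - P5) + (P5 - P4 - rho *: Z2) + rho *: (Z2 - S2) + rho *: (S2 - T2)
  + (P4 - P3 - sg *: S1 - (sg ^+ 2 / 2) *: S11) + sg *: (S1 - T1 - s *: U1)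
  + (sg ^+ 2 / 2) *: (S11 - T11) + (P3 - P0 - s *: P1 - (s ^+ 2 / 2) *: P2).
Proof. by apply/matrixP => i j; rewrite !mxE; field. Qed.

Lemma frobD8 (X1 X2 X3 X4 X5 X6 X7 X8 : 'M[R]_(m, n)) (c1 c2 c3 c4 c5 c6 c7 c8 : R) :
  frob X1 <= c1 -> frob X2 <= c2 -> frob X3 <= c3 -> frob X4 <= c4 ->
  frob X5 <= c5 -> frob X6 <= c6 -> frob X7 <= c7 -> frob X8 <= c8 ->
  frob (X1 + X2 + X3 + X4 + X5 + X6 + X7 + X8)
    <= c1 + c2 + c3 + c4 + c5 + c6 + c7 + c8.
Proof.
by move=> *; do 7 (apply: le_trans (frobD _ _) _; apply: lerD => //).
Qed.

(** F(t + s, p(s)) is expanded along a broken line from (t, Y0): first in time, then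
in the direction e of k1, then in the direction e2 of a2; the cubic term is
absorbed by the Lipschitz bound.  Each leg is a one-dimensional Taylor formula
along a unit direction, with the length of the leg (sg = s B, rho = s^2 g2 / 2)
as its variable. *)
Lemma model_curve t h (Y0 : 'M[R]_(m, n)) : 0 <= t -> 0 <= h <= 1 -> t + h <= T ->
  exists a2 a3 : 'M[R]_(m, n), [/\ frob a2 <= g2, frob a3 <= g3 &
    forall s, 0 <= s <= h ->
      frob (F (t + s) (cubic Y0 (F t Y0) a2 a3 s)
        - (F t Y0 + s *: a2 + (s ^+ 2 / 2) *: a3)) <= C * s ^+ 3].
Proof.
move=> t0 /andP[h0 h1] th; pose D := partial T F.
have tT : 0 <= t <= T by rewrite t0 (le_trans _ th) // lerDl.
have g20 : 0 < g2 := curve_bound2_gt0 B0 M0.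
have g30 : 0 < g3 := curve_bound3_gt0 B0 M0.
have [e1 k1E] := frob_unit_scale B0 (F_bound Y0 tT).
set e := _ *: _ in e1 k1E.
have Dle a Hs X u : (1 <= a + size Hs <= 3)%N -> 0 <= u <= T ->
    all (fun H : 'M[R]_(m, n) => frob H <= 1) Hs -> frob (D a Hs X u) <= M.
  by move=> ? ? /allP; exact: partial_bound.
pose a2 := D 1%N [::] Y0 t + B *: D 0%N [:: e] Y0 t.
have a2g : frob a2 <= g2.
  apply: le_trans (frobD _ _) _; rewrite frobZ gtr0_norm // /curve_bound2 mulrDl mul1r.
  by apply: lerD; [exact: Dle|rewrite ler_pM2l //; apply: Dle => //=; rewrite e1].
have [e21 a2E] := frob_unit_scale g20 a2g.
set e2 := _ *: a2 in e21 a2E.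
pose a3 := D 2%N [::] Y0 t + (2 * B) *: D 1%N [:: e] Y0 t
  + B ^+ 2 *: D 0%N [:: e; e] Y0 t + g2 *: D 0%N [:: e2] Y0 t.
have a3g : frob a3 <= g3.
  have -> : g3 = M + 2 * B * M + B ^+ 2 * M + g2 * M by rewrite /curve_bound3; ring.
  apply: le_trans (frobD _ _) _; apply: lerD; last first.
    by rewrite frobZ gtr0_norm // ler_pM2l //; apply: Dle => //=; rewrite e21.
  apply: le_trans (frobD _ _) _; apply: lerD; last first.
    rewrite frobZ gtr0_norm ?exprn_gt0 // ler_pM2l ?exprn_gt0 //.
    by apply: Dle => //=; rewrite e1.
  apply: le_trans (frobD _ _) _; apply: lerD; first exact: Dle.
  rewrite frobZ gtr0_norm ?mulr_gt0 // ler_pM2l ?mulr_gt0 //.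
  by apply: Dle => //=; rewrite e1.
exists a2, a3; split => //.
move=> s /andP[s0 sh]; have s1 : s <= 1 by exact: le_trans sh h1.
have ts : t + s <= T by apply: le_trans th; rewrite lerD2l.
have tsT u : 0 <= u <= s -> 0 <= t + u <= T.
  move=> /andP[u0 us]; rewrite addr_ge0 //=; apply: le_trans ts; by rewrite lerD2l.
have tss : 0 <= t + s <= T by apply: tsT; rewrite s0 lexx.
have T1 : frob (D 0%N [::] Y0 (t + s) - D 0%N [::] Y0 t - s *: D 1%N [::] Y0 t
    - (s ^+ 2 / 2) *: D 2%N [::] Y0 t) <= M * s ^+ 3.
  have := @taylor3 _ _ _ s (fun u => D 0%N [::] Y0 (t + u))
    (fun u => D 1%N [::] Y0 (t + u)) (fun u => D 2%N [::] Y0 (t + u))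
    (fun u => D 3%N [::] Y0 (t + u)) M s0; rewrite addr0.
  apply; try by move=> u us; apply: partial_time_deriv.
  by move=> u us; apply: Dle => //; exact: tsT.
have T3 : frob (D 0%N [:: e] Y0 (t + s) - D 0%N [:: e] Y0 t
    - s *: D 1%N [:: e] Y0 t) <= M * s ^+ 2.
  have := @taylor2 _ _ _ s (fun u => D 0%N [:: e] Y0 (t + u))
    (fun u => D 1%N [:: e] Y0 (t + u)) (fun u => D 2%N [:: e] Y0 (t + u)) M s0.
  rewrite addr0; apply; try by move=> u us; apply: partial_time_deriv.
  by move=> u us; apply: Dle => //=; rewrite ?e1 //; exact: tsT.
have T4 : frob (D 0%N [:: e; e] Y0 (t + s) - D 0%N [:: e; e] Y0 t) <= M * s.
  have := @taylor1 _ _ _ s (fun u => D 0%N [:: e; e] Y0 (t + u))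
    (fun u => D 1%N [:: e; e] Y0 (t + u)) M s0.
  rewrite addr0; apply; try by move=> u us; apply: partial_time_deriv.
  by move=> u us; apply: Dle => //=; rewrite ?e1 //; exact: tsT.
have T7 : frob (D 0%N [:: e2] Y0 (t + s) - D 0%N [:: e2] Y0 t) <= M * s.
  have := @taylor1 _ _ _ s (fun u => D 0%N [:: e2] Y0 (t + u))
    (fun u => D 1%N [:: e2] Y0 (t + u)) M s0.
  rewrite addr0; apply; try by move=> u us; apply: partial_time_deriv.
  by move=> u us; apply: Dle => //=; rewrite ?e21 //; exact: tsT.
pose sg := s * B; pose Z := Y0 + sg *: e; pose rho := s ^+ 2 * g2 / 2.
have sg0 : 0 <= sg by rewrite mulr_ge0 // ltW.
have rho0 : 0 <= rho by rewrite /rho divr_ge0 // mulr_ge0 ?sqr_ge0 // ltW.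
have T2 : frob (D 0%N [::] Z (t + s) - D 0%N [::] Y0 (t + s)
    - sg *: D 0%N [:: e] Y0 (t + s)
    - (sg ^+ 2 / 2) *: D 0%N [:: e; e] Y0 (t + s)) <= M * sg ^+ 3.
  have := @taylor3 _ _ _ sg (fun u => D 0%N [::] (Y0 + u *: e) (t + s))
    (fun u => D 0%N [:: e] (Y0 + u *: e) (t + s))
    (fun u => D 0%N [:: e; e] (Y0 + u *: e) (t + s))
    (fun u => D 0%N [:: e; e; e] (Y0 + u *: e) (t + s)) M sg0.
  rewrite scale0r addr0; apply; try by move=> u us; apply: partial_line_deriv.
  by move=> u us; apply: Dle => //=; rewrite e1.
have T5 : frob (D 0%N [::] (Z + rho *: e2) (t + s) - D 0%N [::] Z (t + s)
    - rho *: D 0%N [:: e2] Z (t + s)) <= M * rho ^+ 2.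
  have := @taylor2 _ _ _ rho (fun u => D 0%N [::] (Z + u *: e2) (t + s))
    (fun u => D 0%N [:: e2] (Z + u *: e2) (t + s))
    (fun u => D 0%N [:: e2; e2] (Z + u *: e2) (t + s)) M rho0.
  rewrite scale0r addr0; apply; try by move=> u us; apply: partial_line_deriv.
  by move=> u us; apply: Dle => //=; rewrite e21.
have T6 : frob (D 0%N [:: e2] Z (t + s) - D 0%N [:: e2] Y0 (t + s)) <= M * sg.
  have := @taylor1 _ _ _ sg (fun u => D 0%N [:: e2] (Y0 + u *: e) (t + s))
    (fun u => D 0%N [:: e; e2] (Y0 + u *: e) (t + s)) M sg0.
  rewrite scale0r addr0; apply; try by move=> u us; apply: partial_line_deriv.
  by move=> u us; apply: Dle => //=; rewrite e1 e21.
have pE : cubic Y0 (F t Y0) a2 a3 s = Z + rho *: e2 + (s ^+ 3 / 6) *: a3.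
  rewrite /cubic {1}a2E k1E /Z !scalerA; congr (_ + _ + _ + _).
  by congr (_ *: _); rewrite /rho; ring.
have T8 : frob (F (t + s) (cubic Y0 (F t Y0) a2 a3 s)
    - D 0%N [::] (Z + rho *: e2) (t + s)) <= L * (s ^+ 3 / 6 * g3).
  apply: le_trans (F_lip _ _ tss) _; rewrite ler_pM2l // pE addrAC subrr add0r.
  rewrite frobZ ger0_norm ?divr_ge0 ?exprn_ge0 // ler_wpM2l //.
  by rewrite divr_ge0 ?exprn_ge0.
have split_ : F (t + s) (cubic Y0 (F t Y0) a2 a3 s)
      - (F t Y0 + s *: a2 + (s ^+ 2 / 2) *: a3)
  = (F (t + s) (cubic Y0 (F t Y0) a2 a3 s) - D 0%N [::] (Z + rho *: e2) (t + s))
  + (D 0%N [::] (Z + rho *: e2) (t + s) - D 0%N [::] Z (t + s)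
    - rho *: D 0%N [:: e2] Z (t + s))
  + rho *: (D 0%N [:: e2] Z (t + s) - D 0%N [:: e2] Y0 (t + s))
  + rho *: (D 0%N [:: e2] Y0 (t + s) - D 0%N [:: e2] Y0 t)
  + (D 0%N [::] Z (t + s) - D 0%N [::] Y0 (t + s)
    - sg *: D 0%N [:: e] Y0 (t + s)
    - (sg ^+ 2 / 2) *: D 0%N [:: e; e] Y0 (t + s))
  + sg *: (D 0%N [:: e] Y0 (t + s) - D 0%N [:: e] Y0 t
    - s *: D 1%N [:: e] Y0 t)
  + (sg ^+ 2 / 2) *: (D 0%N [:: e; e] Y0 (t + s) - D 0%N [:: e; e] Y0 t)
  + (D 0%N [::] Y0 (t + s) - D 0%N [::] Y0 t - s *: D 1%N [::] Y0 t
    - (s ^+ 2 / 2) *: D 2%N [::] Y0 t).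
  exact: telescope_model.
rewrite split_.
have s3 : 0 <= s ^+ 3 by rewrite exprn_ge0.
have s2s : s ^+ 4 <= s ^+ 3 by rewrite [leLHS]exprS ler_piMl.
have n5 : M * rho ^+ 2 <= M * g2 ^+ 2 * s ^+ 3.
  have -> : M * rho ^+ 2 = M * g2 ^+ 2 * (s ^+ 4 / 4) by rewrite /rho; field.
  apply: ler_wpM2l; first exact: mulr_ge0 (ltW M0) (sqr_ge0 _).
  apply: (le_trans _ s2s); have s40 : 0 <= s ^+ 4 by rewrite exprn_ge0.
  by rewrite ler_pdivrMr // ler_peMr // ler1n.
have n6 : frob (rho *: (D 0%N [:: e2] Z (t + s) - D 0%N [:: e2] Y0 (t + s)))
    <= M * (B * g2) * s ^+ 3 / 2.
  rewrite frobZ ger0_norm //; apply: le_trans (ler_wpM2l rho0 T6) _.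
  by rewrite le_eqVlt; apply/orP; left; apply/eqP; rewrite /rho /sg; field.
have n7 : frob (rho *: (D 0%N [:: e2] Y0 (t + s) - D 0%N [:: e2] Y0 t))
    <= M * g2 * s ^+ 3 / 2.
  rewrite frobZ ger0_norm //; apply: le_trans (ler_wpM2l rho0 T7) _.
  by rewrite le_eqVlt; apply/orP; left; apply/eqP; rewrite /rho; field.
have n2 : M * sg ^+ 3 = M * B ^+ 3 * s ^+ 3 by rewrite /sg exprMn; ring.
have n3 : frob (sg *: (D 0%N [:: e] Y0 (t + s) - D 0%N [:: e] Y0 t
    - s *: D 1%N [:: e] Y0 t)) <= M * B * s ^+ 3.
  rewrite frobZ ger0_norm //; apply: le_trans (ler_wpM2l sg0 T3) _.
  by rewrite le_eqVlt; apply/orP; left; apply/eqP; rewrite /sg; ring.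
have n4 : frob ((sg ^+ 2 / 2) *: (D 0%N [:: e; e] Y0 (t + s) - D 0%N [:: e; e] Y0 t))
    <= M * B ^+ 2 * s ^+ 3 / 2.
  have q0 : 0 <= sg ^+ 2 / 2 by rewrite divr_ge0 // sqr_ge0.
  rewrite frobZ ger0_norm //; apply: le_trans (ler_wpM2l q0 T4) _.
  by rewrite le_eqVlt; apply/orP; left; apply/eqP; rewrite /sg; field.
have n8 : L * (s ^+ 3 / 6 * g3) = L * g3 * s ^+ 3 / 6 by field.
rewrite n2 in T2; rewrite n8 in T8.
have := le_trans T5 n5 => {}T5.
have bound8 := frobD8 T8 T5 n6 n7 T2 n3 n4 T1.
apply: (le_trans bound8); exact: curve_defect_sum.
Qed.

End Model.

(** * Errors of the Heun stages *)


(** The arithmetic common to all three K-L steps: the increment is off the model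
curve by w, and the splitting contributes E s (eps + h^3). *)
Lemma stage_bound (R : realType) (E D h s eps e w : R) (k : nat) :
  0 <= E -> 0 <= D -> 0 <= eps -> 0 < h -> h <= 1 -> 0 < s <= h -> (k <= 3)%N ->
  w <= D * (h ^+ k.+1 + h * eps) ->
  e <= 4 * w + E * s * (eps + h ^+ 3) ->
  e <= (4 * D + E) * (h ^+ k.+1 + h * eps).
Proof.
move=> E0 D0 eps0 h0 h1 /andP[s0 sh] k3 hw he.
have h3k : h ^+ 3 <= h ^+ k by apply: ler_wiXn2l => //; exact: ltW.
have q1 : s * (eps + h ^+ 3) <= h ^+ k.+1 + h * eps.
  rewrite [h ^+ k.+1]exprS -mulrDr addrC; apply: ler_pM => //; first exact: ltW.
    by rewrite addr_ge0 // exprn_ge0 // ltW.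
  by rewrite lerD2r.
have q2 : E * s * (eps + h ^+ 3) <= E * (h ^+ k.+1 + h * eps).
  by rewrite -mulrA ler_wpM2l.
rewrite mulrDl -mulrA; apply: (le_trans he); apply: lerD => //.
by rewrite ler_pM2l.
Qed.

Section LocalError.
Variables (R : realType) (m n r : nat) (T B L M eps : R).
Hypotheses (rm : (r < m)%N) (rn : (r < n)%N).
Hypotheses (B0 : 0 < B) (L0 : 0 < L) (M0 : 0 < M) (eps0 : 0 <= eps).
Variable (F : R -> 'M[R]_(m, n) -> 'M[R]_(m, n)).
Hypothesis F_bound : forall t X, 0 <= t <= T -> frob (F t X) <= B.
Hypothesis F_lip : forall t X Z, 0 <= t <= T ->
  frob (F t X - F t Z) <= L * frob (X - Z).
Hypothesis F_tan : forall t (y : factors R m n r), 0 <= t <= T -> is_rank_factors y ->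
  frob ((1%:M - facU y *m (facU y)^T) *m F t (fmat y) *m
        (1%:M - facV y *m (facV y)^T)) <= eps.

Local Notation nu := (graph_bound R n).
Local Notation c := (transport_rate n L).
Local Notation g2 := (curve_bound2 B M).
Local Notation g3 := (curve_bound3 B M).
Local Notation C := (curve_defect B L M).

(** The constant of the contribution of the kernel transport to the splitting
error. *)
Definition splitting_const : R :=
  4 * (2 * (n%:R * nu) + nu * (C + g2 + g3) + B * c).
Local Notation E1 := splitting_const.

Variables (t h : R) (y0 : factors R m n r) (k1 a2 a3 : 'M[R]_(m, n)).
Hypotheses (t0 : 0 <= t) (h0 : 0 < h) (h1 : h <= 1) (th : t + h <= T).
Hypothesis hc : h * c <= 1 / 2.
Hypothesis hy0 : orthonormal_cols (facV y0).
Hypotheses (a2g : frob a2 <= g2) (a3g : frob a3 <= g3).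
Local Notation p := (cubic (fmat y0) k1 a2 a3).
Local Notation p' s := (k1 + s *: a2 + (s ^+ 2 / 2) *: a3).
Hypothesis p_defect : forall s, 0 <= s <= h ->
  frob (F (t + s) (p s) - p' s) <= C * s ^+ 3.

Let g20 : 0 < g2 := curve_bound2_gt0 B0 M0.
Let g30 : 0 < g3 := curve_bound3_gt0 B0 M0.
Let C0 : 0 < C := curve_defect_gt0 B0 L0 M0.

Lemma defect_h s : 0 <= s <= h -> frob (F (t + s) (p s) - p' s) <= C * h ^+ 3.
Proof.
move=> sh; apply: le_trans (p_defect sh) _; move: sh => /andP[s0 sh].
by rewrite ler_pM2l // ler_pXn2r ?nnegrE // (le_trans s0).
Qed.

Lemma splitting_const_ge0 : 0 <= E1.
Proof.
have S0 : 0 <= C + g2 + g3 := addr_ge0 (addr_ge0 (ltW C0) (ltW g20)) (ltW g30).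
have q1 : 0 <= n%:R * nu := mulr_ge0 (ler0n R n) (graph_bound_ge0 R n).
have q2 : 0 <= nu * (C + g2 + g3) := mulr_ge0 (graph_bound_ge0 R n) S0.
have q3 : 0 <= B * c := mulr_ge0 (ltW B0) (transport_rate_ge0 n (ltW L0)).
by rewrite /splitting_const; apply: mulr_ge0 => //; rewrite !addr_ge0 // mulr_ge0.
Qed.

(** The kernel is transported along the model curve in substeps tau <= h^3, so that
the quadratic Euler error per substep is at most tau times O(h^3), the size of
the defect of the curve.  The level a = eps + h^3 stays strictly above eps even
when eps = 0, and costs only O(s h^3). *)
Lemma KL_stage_error s y1 (dA : 'M[R]_(m, n)) : 0 < s <= h ->
  KL_step y0 dA y1 ->
  frob (fmat y1 - (fmat y0 + dA)) <=
    3 * frob (fmat y0 + dA - p s) + E1 * s * (eps + h ^+ 3).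
Proof.
move=> /andP[s0 sh] st.
have h3 : 0 < h ^+ 3 by rewrite exprn_gt0.
have [K Kb] : exists K : nat, s / h ^+ 3 < K.+1%:R.
  by exists (Num.truncn (s / h ^+ 3)); exact: truncnS_gt.
have K0 : 0 < K.+1%:R :> R by rewrite ltr0Sn.
pose tau := s / K.+1%:R; have tau0 : 0 < tau by rewrite divr_gt0.
have Ktau : K.+1%:R * tau = s by rewrite /tau mulrCA mulfV ?mulr1 // gt_eqF.
have tau_h : tau <= h ^+ 3.
  by rewrite /tau ler_pdivrMr // mulrC -ler_pdivrMr // ltW.
have h31 : h ^+ 3 <= 1 by rewrite exprn_ile1 // ltW.
have grid j : (j <= K.+1)%N -> 0 <= j%:R * tau <= s.
  move=> jK; rewrite mulr_ge0 ?(ltW tau0) //= -Ktau ler_wpM2r ?(ltW tau0) //.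
  by rewrite ler_nat.
have gridT j : (j <= K.+1)%N -> 0 <= t + j%:R * tau <= T.
  move=> /grid /andP[u0 us]; rewrite addr_ge0 //=; apply: le_trans th.
  by rewrite lerD2l (le_trans us).
pose f j X := F (t + j%:R * tau) X.
pose d := (C + g2 + g3) * h ^+ 3.
have S0 : 0 <= C + g2 + g3 := addr_ge0 (addr_ge0 (ltW C0) (ltW g20)) (ltW g30).
have d0 : 0 <= d := mulr_ge0 S0 (ltW h3).
have ea : eps < eps + h ^+ 3 by rewrite ltrDl.
have euler j : (j < K.+1)%N ->
    frob (p (j.+1%:R * tau) - p (j%:R * tau) - tau *: f j (p (j%:R * tau)))
      <= tau * d.
  move=> jK; have /andP[u0 us] := grid j (ltnW jK).
  set u := j%:R * tau in u0 us *; have -> : j.+1%:R * tau = u + tau.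
    by rewrite -natr1 mulrDl mul1r.
  have -> : p (u + tau) - p u - tau *: f j (p u) =
     tau *: ((tau / 2) *: a2 + (u * tau / 2 + tau ^+ 2 / 6) *: a3
       - (F (t + u) (p u) - p' u)).
    rewrite /f -/u; move: (F (t + u) (p u)) => X.
    by apply/matrixP => i k; rewrite !mxE; field.
  have u1 : u <= 1 by rewrite (le_trans us) // (le_trans sh).
  have tau1 : tau <= 1 by exact: le_trans tau_h h31.
  rewrite frobZ gtr0_norm // ler_pM2l //; apply: le_trans (frobB _ _) _.
  have w1 : frob (F (t + u) (p u) - p' u) <= C * h ^+ 3.
    by apply: defect_h; rewrite u0 (le_trans us).
  have w2 : frob ((tau / 2) *: a2 + (u * tau / 2 + tau ^+ 2 / 6) *: a3)
      <= h ^+ 3 * g2 + h ^+ 3 * g3.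
    apply: le_trans (frobD _ _) _; rewrite !frobZ; apply: lerD.
      apply: ler_pM; rewrite ?frob_ge0 // gtr0_norm ?divr_gt0 //; lra.
    apply: ler_pM; rewrite ?frob_ge0 // ger0_norm; last first.
      by rewrite addr_ge0 ?divr_ge0 ?mulr_ge0 ?sqr_ge0 // ltW.
    apply: le_trans tau_h.
    have : u * tau <= 1 * tau by rewrite ler_pM2r.
    have : tau ^+ 2 <= 1 * tau by rewrite expr2 ler_pM2r.
    lra.
  by rewrite /d; lra.
have [||E [hE hD]] := @kernel_transport R m n r L B eps (eps + h ^+ 3) rm rn L0 eps0 ea
  (facV y0) hy0 f (fun j => p (j%:R * tau)) d tau K.+1
  (fun j X Z jK => F_lip X Z (gridT j (ltnW jK)))
  (fun j y jK hy => F_tan (gridT j (ltnW jK)) hy)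
  (fun j X jK => F_bound X (gridT j (ltnW jK))) (ltW tau0) d0 _ euler _.
- have -> : p (0%:R * tau) = fmat y0 by apply/matrixP => i k; rewrite !mxE; field.
  by rewrite /fmat -mulmxA frame_coproj // mulmx0.
- rewrite Ktau; apply: le_trans hc; rewrite ler_wpM2r //.
  by apply: transport_rate_ge0; exact: ltW.
apply: le_trans (KL_step_error (p s) hy0 st hE) _; rewrite lerD2l.
move: hD; rewrite Ktau => hD; apply: le_trans (ler_wpM2l _ hD) _ => //.
have c0 : 0 <= B * c := mulr_ge0 (ltW B0) (transport_rate_ge0 n (ltW L0)).
have q1 : tau * B * c <= (eps + h ^+ 3) * (B * c).
  by rewrite -mulrA ler_wpM2r //; apply: le_trans tau_h _; rewrite lerDr.
have q2 : nu * d <= (eps + h ^+ 3) * (nu * (C + g2 + g3)).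
  have -> : nu * d = h ^+ 3 * (nu * (C + g2 + g3)) by rewrite /d; ring.
  apply: ler_wpM2r; last by rewrite lerDr.
  exact: mulr_ge0 (graph_bound_ge0 R n) S0.
rewrite (mulrA 2 (2 * s)).
have -> : E1 * s * (eps + h ^+ 3) = 2 * (2 * s) *
    (2 * (n%:R * nu * (eps + h ^+ 3)) + (eps + h ^+ 3) * (nu * (C + g2 + g3))
      + (eps + h ^+ 3) * (B * c)).
  by rewrite /splitting_const; ring.
by apply: ler_wpM2l; [rewrite !mulr_ge0 // ltW|rewrite !lerD].
Qed.

Definition stage2_const : R := 4 * (g2 + g3) + E1.
Definition stage3_defect : R := L * stage2_const + C + g3.
Definition stage3_const : R := 4 * stage3_defect + E1.
Definition increment_const : R := L * stage3_const + C.
Definition step_const : R := 4 * increment_const + E1.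

Local Notation D2 := stage2_const.
Local Notation D3 := stage3_const.
Local Notation D4 := increment_const.
Local Notation D5 := step_const.

Hypothesis k1E : k1 = F t (fmat y0).

Lemma stage2_const_ge0 : 0 <= D2.
Proof. by rewrite addr_ge0 ?splitting_const_ge0 // mulr_ge0 // addr_ge0 // ltW. Qed.

Lemma stage3_defect_ge0 : 0 <= stage3_defect.
Proof.
have q1 := mulr_ge0 (ltW L0) stage2_const_ge0.
exact: addr_ge0 (addr_ge0 q1 (ltW C0)) (ltW g30).
Qed.

Lemma increment_const_ge0 : 0 <= D4.
Proof.
have q0 : 0 <= D3.
  by rewrite addr_ge0 ?splitting_const_ge0 // mulr_ge0 // stage3_defect_ge0.
exact: addr_ge0 (mulr_ge0 (ltW L0) q0) (ltW C0).
Qed.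

Lemma KL_stage_total s y1 (dA : 'M[R]_(m, n)) : 0 < s <= h -> KL_step y0 dA y1 ->
  frob (fmat y1 - p s) <=
    4 * frob (fmat y0 + dA - p s) + E1 * s * (eps + h ^+ 3).
Proof.
move=> sh st; apply: le_trans (frob_dist _ (fmat y0 + dA) _) _.
have := KL_stage_error sh st.
by move: (frob _) (frob (_ - p s)) (E1 * s * _) => X Y Z; lra.
Qed.

Lemma F_model_dist s X : 0 <= s <= h ->
  frob (F (t + s) X - p' s) <= L * frob (X - p s) + C * h ^+ 3.
Proof.
move=> sh; have tT : 0 <= t + s <= T.
  by move: sh => /andP[u0 us]; rewrite addr_ge0 //= (le_trans _ th) // lerD2l.
apply: le_trans (frob_dist _ (F (t + s) (p s)) _) _.
by apply: lerD; [exact: F_lip | exact: defect_h].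
Qed.

Lemma h2eps_le : h ^+ 2 * eps <= h * eps.
Proof. by rewrite ler_wpM2r // expr2 ler_piMr // ltW. Qed.

Lemma heun_stage2 y2 : KL_step y0 (heun_dA2 F h t y0) y2 ->
  frob (fmat y2 - p (h / 3)) <= D2 * (h ^+ 2 + h * eps).
Proof.
move=> st; have s3 : 0 < h / 3 <= h by apply/andP; split; move: h0; lra.
apply: stage_bound (KL_stage_total s3 st) => //; first exact: splitting_const_ge0.
  by rewrite addr_ge0 // ltW.
have -> : fmat y0 + heun_dA2 F h t y0 - p (h / 3)
    = - ((h ^+ 2 / 18) *: a2 + (h ^+ 3 / 162) *: a3).
  by rewrite /heun_dA2 -k1E; apply/matrixP => i j; rewrite !mxE; field.
have hh : h ^+ 3 <= h ^+ 2 by rewrite exprSr ler_piMr ?sqr_ge0.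
have h2 : 0 <= h ^+ 2 by rewrite sqr_ge0.
have h3 : 0 <= h ^+ 3 by rewrite exprn_ge0 // ltW.
apply: (@le_trans _ _ ((g2 + g3) * h ^+ 2)); last first.
  rewrite ler_wpM2l ?lerDl ?mulr_ge0 // ?exprn_ge0 ?(ltW h0) //.
  by rewrite addr_ge0 // ltW.
rewrite frobN [leRHS]mulrC mulrDr; apply: le_trans (frobD _ _) _; rewrite !frobZ.
by apply: lerD; apply: ler_pM; rewrite ?frob_ge0 // ger0_norm; lra.
Qed.

(** The midpoint rule reproduces p(2h/3) up to the cubic coefficient of p. *)
Lemma heun_stage3 y2 y3 : KL_step y0 (heun_dA2 F h t y0) y2 ->
  KL_step y0 (heun_dA3 F h t y2) y3 ->
  frob (fmat y3 - p (2 * h / 3)) <= D3 * (h ^+ 3 + h * eps).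
Proof.
move=> st2 st; have s3 : 0 < 2 * h / 3 <= h by apply/andP; split; move: h0; lra.
have s3' : 0 <= h / 3 <= h by apply/andP; split; move: h0; lra.
apply: stage_bound (KL_stage_total s3 st) => //; first exact: splitting_const_ge0.
  exact: stage3_defect_ge0.
apply: (@le_trans _ _ (stage3_defect * (h ^+ 3 + h ^+ 2 * eps))); last first.
  by rewrite ler_wpM2l ?stage3_defect_ge0 // lerD2l h2eps_le.
have -> : fmat y0 + heun_dA3 F h t y2 - p (2 * h / 3)
    = (2 * h / 3) *: (F (t + h / 3) (fmat y2) - p' (h / 3))
      - (h ^+ 3 / 81) *: a3.
  by rewrite /heun_dA3; apply/matrixP => i j; rewrite !mxE; field.
have e2 := heun_stage2 st2.
have FM := F_model_dist (fmat y2) s3'.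
have e2' : L * frob (fmat y2 - p (h / 3)) <= L * (D2 * (h ^+ 2 + h * eps)).
  by rewrite ler_pM2l.
apply: le_trans (frobB _ _) _; rewrite !frobZ gtr0_norm; last by lra.
rewrite ger0_norm ?divr_ge0 ?exprn_ge0 ?(ltW h0) //.
have h30 : 0 <= h ^+ 3 by rewrite exprn_ge0 // ltW.
have h43 : h ^+ 4 <= h ^+ 3 by rewrite exprSr ler_piMr.
have he : 0 <= h ^+ 2 * eps by rewrite mulr_ge0 ?sqr_ge0.
have u1 : 2 * h / 3 * frob (F (t + h / 3) (fmat y2) - p' (h / 3))
   <= h * (L * (D2 * (h ^+ 2 + h * eps)) + C * h ^+ 3).
  apply: ler_pM; rewrite ?frob_ge0 //; [lra|lra|].
  by apply: (le_trans FM); rewrite lerD2r.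
have u2 : h ^+ 3 / 81 * frob a3 <= h ^+ 3 * g3.
  by apply: ler_pM; rewrite ?frob_ge0 ?divr_ge0 //; lra.
have u3 : C * h ^+ 4 <= C * h ^+ 3 by rewrite ler_pM2l.
have u4 : 0 <= (C + g3) * (h ^+ 2 * eps) by rewrite mulr_ge0 // addr_ge0 // ltW.
apply: (le_trans (lerD u1 u2)).
have -> : h * (L * (D2 * (h ^+ 2 + h * eps)) + C * h ^+ 3) + h ^+ 3 * g3
  = L * D2 * (h ^+ 3 + h ^+ 2 * eps) + C * h ^+ 4 + g3 * h ^+ 3 by ring.
have -> : stage3_defect * (h ^+ 3 + h ^+ 2 * eps)
  = L * D2 * (h ^+ 3 + h ^+ 2 * eps) + C * h ^+ 3 + g3 * h ^+ 3
    + (C + g3) * (h ^+ 2 * eps) by rewrite /stage3_defect; ring.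
by apply: le_trans (lerD (lerD (lexx _) u3) (lexx _)) _; rewrite lerDl.
Qed.

(** The weights 1/4 at 0 and 3/4 at 2h/3 integrate the quadratic p' exactly, so only
the error of the last stage and the defect of p remain. *)
Lemma heun_increment y2 y3 : KL_step y0 (heun_dA2 F h t y0) y2 ->
  KL_step y0 (heun_dA3 F h t y2) y3 ->
  frob (fmat y0 + heun_dA F h t y0 y3 - p h) <= D4 * (h ^+ 4 + h ^+ 2 * eps).
Proof.
move=> st2 st; have s3 : 0 <= 2 * h / 3 <= h by apply/andP; split; move: h0; lra.
have -> : fmat y0 + heun_dA F h t y0 y3 - p h
    = (3 * h / 4) *: (F (t + 2 * h / 3) (fmat y3) - p' (2 * h / 3)).
  by rewrite /heun_dA -k1E; apply/matrixP => i j; rewrite !mxE; field.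
have e3 := heun_stage3 st2 st.
have FM := F_model_dist (fmat y3) s3.
have e3' : L * frob (fmat y3 - p (2 * h / 3)) <= L * (D3 * (h ^+ 3 + h * eps)).
  by rewrite ler_pM2l.
rewrite frobZ gtr0_norm; last by move: h0; lra.
have he : 0 <= C * (h ^+ 2 * eps) := mulr_ge0 (ltW C0) (mulr_ge0 (sqr_ge0 _) eps0).
apply: (@le_trans _ _ (h * (L * (D3 * (h ^+ 3 + h * eps)) + C * h ^+ 3))).
  apply: ler_pM; rewrite ?frob_ge0 //; [move: h0; lra|move: h0; lra|].
  by apply: (le_trans FM); rewrite lerD2r.
have -> : D4 * (h ^+ 4 + h ^+ 2 * eps) =
   h * (L * (D3 * (h ^+ 3 + h * eps)) + C * h ^+ 3) + C * (h ^+ 2 * eps).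
  by rewrite /increment_const; ring.
by rewrite lerDl.
Qed.

Lemma heun_output y2 y3 y1 : heun_step F h t y0 y2 y3 y1 ->
  frob (fmat y1 - p h) <= D5 * (h ^+ 4 + h * eps).
Proof.
move=> [st2 st3 st]; have hh : 0 < h <= h by rewrite h0 lexx.
apply: stage_bound (KL_stage_total hh st) => //; first exact: splitting_const_ge0.
  exact: increment_const_ge0.
apply: le_trans (heun_increment st2 st3) _.
by rewrite ler_wpM2l ?increment_const_ge0 // lerD2l h2eps_le.
Qed.

End LocalError.

(** * Stability and error accumulation *)


Section Comparison.
Variables (R : realType) (m n : nat).

(** Let mu be the supremum of |A - p| on the interval, finite because G is bounded.
The mean value inequality gives mu <= |A 0 - p 0| + h (L mu + d), which
h L <= 1/2 solves for mu; inserting this once more gives the factor 1 + 2 L h in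
front of the initial error, as needed for summation over many steps. *)
Lemma curve_stability (G : R -> 'M[R]_(m, n) -> 'M[R]_(m, n)) (B L d h : R)
    (A p p' : R -> 'M[R]_(m, n)) :
  0 <= h -> 0 < L -> h * L <= 1 / 2 -> 0 <= d ->
  (forall s X, 0 <= s <= h -> frob (G s X) <= B) ->
  (forall s X Z, 0 <= s <= h -> frob (G s X - G s Z) <= L * frob (X - Z)) ->
  (forall s, 0 <= s <= h -> deriv_in 0 h A s (G s (A s))) ->
  (forall s, 0 <= s <= h -> deriv_in 0 h p s (p' s)) ->
  (forall s, 0 <= s <= h -> frob (G s (p s) - p' s) <= d) ->
  frob (A h - p h) <= (1 + 2 * L * h) * frob (A 0 - p 0) + 2 * (h * d).
Proof.
move=> h0 L0 hL d0 GB GL dA dp pd.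
pose e s := A s - p s; pose e' s := G s (A s) - p' s.
have de s : 0 <= s <= h -> deriv_in 0 h e s (e' s).
  by move=> sh; apply: deriv_inB; [exact: dA|exact: dp].
have e'le s : 0 <= s <= h -> frob (e' s) <= L * frob (e s) + d.
  move=> sh; apply: le_trans (frob_dist _ (G s (p s)) _) _.
  by apply: lerD; [exact: GL|exact: pd].
(* This crude bound only serves to make the supremum below finite. *)
have e'B s : 0 <= s <= h -> frob (e' s) <= 2 * B + d.
  move=> sh; apply: le_trans (frob_dist _ (G s (p s)) _) _.
  apply: lerD; last exact: pd.
  apply: le_trans (frobB _ _) _; have := GB s (A s) sh; have := GB s (p s) sh.
  by move: (frob _) (frob _) => x y; lra.
have grow b s : 0 <= s <= h -> (forall u, 0 <= u <= h -> frob (e' u) <= b) ->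
    frob (e s) <= frob (e 0) + h * b.
  move=> /andP[s0 sh] hb.
  have b0 : 0 <= b by apply: le_trans (frob_ge0 (e' 0)) (hb 0 _); rewrite lexx.
  have -> : e s = e 0 + (e s - e 0) by rewrite addrC subrK.
  apply: le_trans (frobD _ _) _; rewrite lerD2l.
  have := @taylor1 R m n s e e' b s0; move/(_ _ _)/le_trans; apply.
  - move=> u /andP[u0 us]; apply: (deriv_in_sub (lexx 0) sh).
    by apply: de; rewrite u0 (le_trans us).
  - by move=> u /andP[u0 us]; apply: hb; rewrite u0 (le_trans us).
  - by rewrite mulrC ler_wpM2r.
pose S := [set x : R | exists2 s, 0 <= s <= h & x = frob (e s)].
have Sb : has_ubound S.
  by exists (frob (e 0) + h * (2 * B + d)) => _ [s sh ->]; exact: grow.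
have S0 : S !=set0 by exists (frob (e 0)); exists 0; rewrite ?lexx.
pose mu := sup S.
have le_mu s : 0 <= s <= h -> frob (e s) <= mu.
  by move=> sh; apply: ub_le_sup => //; exists s.
have grow_mu s : 0 <= s <= h -> frob (e s) <= frob (e 0) + h * (L * mu + d).
  move=> sh; apply: grow => // u uh; apply: le_trans (e'le u uh) _.
  by rewrite lerD2r ler_pM2l //; exact: le_mu.
have mu_le : mu <= frob (e 0) + h * (L * mu + d).
  by apply: ge_sup => // _ [s sh ->]; exact: grow_mu.
have mu0 : 0 <= mu by apply: le_trans (frob_ge0 (e 0)) (le_mu 0 _); rewrite lexx.
have hmu : h * L * mu <= 1 / 2 * mu by rewrite ler_wpM2r.
have hh : 0 <= h <= h by rewrite h0 lexx.
have mu2 : mu <= 2 * (frob (e 0) + h * d).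
  by move: mu_le hmu; rewrite mulrDr mulrA; lra.
apply: le_trans (grow_mu h hh) _.
have hLmu : h * L * mu <= h * L * (2 * (frob (e 0) + h * d)).
  by rewrite ler_wpM2l // mulr_ge0 // ltW.
have hd : h * L * (h * d) <= 1 / 2 * (h * d) by rewrite ler_wpM2r // mulr_ge0.
by move: hLmu hd; rewrite -/(e 0) mulrDr mulrA; lra.
Qed.

(** Discrete Gronwall inequality. *)
Lemma recursion_bound (a g h d : R) (e : nat -> R) (N : nat) :
  0 <= a -> 0 <= g -> 0 <= h -> 0 <= d -> e 0%N <= d ->
  (forall k, (k < N)%N -> e k.+1 <= (1 + a * h) * e k + h * g) ->
  forall k, (k <= N)%N -> e k <= expR (a * (k%:R * h)) * (d + k%:R * h * g).
Proof.
move=> a0 g0 h0 d0 e0 H; elim=> [|k IH] kN.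
  by rewrite !mul0r mulr0 expR0 mul1r addr0.
apply: le_trans (H k kN) _; have {}IH := IH (ltnW kN).
have ah : 0 <= a * h by rewrite mulr_ge0.
have -> : a * (k.+1%:R * h) = a * h + a * (k%:R * h) by rewrite -natr1; ring.
have -> : k.+1%:R * h * g = k%:R * h * g + h * g by rewrite -natr1; ring.
have x0 : 0 <= a * (k%:R * h) by rewrite !mulr_ge0.
have y0 : 0 <= d + k%:R * h * g by rewrite addr_ge0 ?mulr_ge0.
rewrite addrA mulrDr; apply: lerD.
  apply: (@le_trans _ _ ((1 + a * h) * (expR (a * (k%:R * h)) * (d + k%:R * h * g)))).
    by rewrite ler_wpM2l // addr_ge0.
  rewrite mulrA ler_wpM2r // expRD ler_wpM2r ?expR_ge0 //; exact: expR_ge1Dx.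
rewrite ler_peMl ?mulr_ge0 //.
by apply: le_trans (expR_ge1Dx _); rewrite lerDl addr_ge0.
Qed.

End Comparison.

(** * Local and global error *)


Section HeunLocal.
Variables (R : realType) (m n r : nat) (T B L M eps : R).
Hypotheses (rm : (r < m)%N) (rn : (r < n)%N).
Hypotheses (B0 : 0 < B) (L0 : 0 < L) (M0 : 0 < M).
Variable (F : R -> 'M[R]_(m, n) -> 'M[R]_(m, n)).
Hypotheses (sF : @standing_assumptions R m n r T B L eps F).
Hypotheses (CF : class_C T 3 F) (bF : bounded_partials T 3 M F).

(** One point P, the end point of the model curve, is close both to the output of
the method and, up to the propagated initial error, to every exact solution. *)
Lemma heun_local t h (y0 y2 y3 y1 : factors R m n r) :
  0 <= t -> 0 < h -> h <= 1 -> t + h <= T ->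
  h * transport_rate n L <= 1 / 2 -> h * L <= 1 / 2 ->
  orthonormal_cols (facV y0) -> heun_step F h t y0 y2 y3 y1 ->
  exists P : 'M[R]_(m, n),
  [/\ frob (fmat y0 + heun_dA F h t y0 y3 - P)
        <= increment_const n B L M * (h ^+ 4 + h ^+ 2 * eps),
      frob (fmat y1 - P) <= step_const n B L M * (h ^+ 4 + h * eps) &
      forall A : R -> 'M[R]_(m, n),
        (forall s, 0 <= s <= h -> deriv_in 0 h A s (F (t + s) (A s))) ->
        frob (A h - P) <= (1 + 2 * L * h) * frob (A 0 - fmat y0)
          + 2 * (h * (curve_defect B L M * h ^+ 3))].
Proof.
move=> t0 h0 h1 th hc hL hV st.
have [_ F_bound F_lip eps0 F_tan] := sF.
have h01 : 0 <= h <= 1 by rewrite ltW.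
have [a2 [a3 [a2g a3g pd]]] :=
  model_curve B0 L0 M0 CF bF F_bound F_lip (fmat y0) t0 h01 th.
have C0 := curve_defect_gt0 B0 L0 M0.
exists (cubic (fmat y0) (F t (fmat y0)) a2 a3 h); split.
- have [st2 st3 _] := st.
  exact: (heun_increment rm rn B0 L0 M0 eps0 F_bound F_lip F_tan t0 h0 h1 th hc
    hV a2g a3g pd erefl st2 st3).
- exact: (heun_output rm rn B0 L0 M0 eps0 F_bound F_lip F_tan t0 h0 h1 th hc
    hV a2g a3g pd erefl st).
move=> A dA.
have inT s : 0 <= s <= h -> 0 <= t + s <= T.
  by move=> /andP[s0 sh]; rewrite addr_ge0 //= (le_trans _ th) // lerD2l.
have E0 : fmat y0 = cubic (fmat y0) (F t (fmat y0)) a2 a3 0.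
  by apply/matrixP => i j; rewrite !mxE; field.
rewrite [in X in _ <= X]E0.
apply: (@curve_stability _ _ _ (fun s X => F (t + s) X) B L _ h A
  (cubic (fmat y0) (F t (fmat y0)) a2 a3)
  (fun s => F t (fmat y0) + s *: a2 + (s ^+ 2 / 2) *: a3)) => //.
- exact: ltW.
- by rewrite mulr_ge0 ?exprn_ge0 // ltW.
- by move=> s X sh; apply: F_bound; exact: inT.
- by move=> s X Z sh; apply: F_lip; exact: inT.
- by move=> s sh; exact: deriv_in_cubic.
move=> s sh; apply: le_trans (pd s sh) _; move: sh => /andP[s0 sh].
by rewrite ler_pM2l // ler_pXn2r ?nnegrE // ltW.
Qed.

End HeunLocal.

Theorem mainTheorem8 (R : realType) (m n r : nat) (B LF M : R)
    (hr0 : (1 <= r)%N) (hr : (r < minn m n)%N) :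
  exists h0 C : R, 0 < h0 /\
  forall T : R, 0 < T ->
  exists CT : R,
  forall (eps : R) (F : R -> 'M[R]_(m, n) -> 'M[R]_(m, n)),
  @standing_assumptions R m n r T B LF eps F ->
  class_C T 3 F ->
  bounded_partials T 3 M F ->
  forall h : R, 0 < h <= h0 ->
  (* (i) *)
  (forall (t : R) (y0 y2 y3 y1 : factors R m n r) (A : R -> 'M[R]_(m, n)),
     0 <= t <= T - h ->
     is_rank_factors y0 ->
     heun_step F h t y0 y2 y3 y1 ->
     heun_admissible F h t y0 y2 y3 ->
     A 0 = fmat y0 ->
     (forall s, 0 <= s <= h -> has_deriv_on `[0, h] A s (F (t + s) (A s))) ->
     frob (fmat y0 + heun_dA F h t y0 y3 - A h) <= C * (h ^+ 4 + h ^+ 2 * eps) /\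
     frob (fmat y1 - A h) <= C * (h ^+ 4 + h * eps)) /\
  (* (ii) *)
  (forall (t0 delta : R) (A : R -> 'M[R]_(m, n)) (y y2 y3 : nat -> factors R m n r),
     0 <= t0 <= T ->
     (forall t, t0 <= t <= T -> has_deriv_on `[t0, T] A t (F t (A t))) ->
     is_rank_factors (y 0%N) ->
     frob (fmat (y 0%N) - A t0) <= delta ->
     (forall k : nat, t0 + k.+1%:R * h <= T ->
        heun_step F h (t0 + k%:R * h) (y k) (y2 k) (y3 k) (y k.+1) /\
        heun_admissible F h (t0 + k%:R * h) (y k) (y2 k) (y3 k)) ->
     forall k : nat, t0 + k%:R * h <= T ->
       frob (fmat (y k) - A (t0 + k%:R * h)) <= CT * (delta + eps + h ^+ 3)).
Proof.
have [rm rn] : (r < m)%N /\ (r < n)%N by apply/andP; rewrite -leq_min.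
(* The given bounds may be zero or negative. *)
pose b := 1 + `|B|; pose L := 1 + `|LF|; pose mu := 1 + `|M|.
have b0 : 0 < b by rewrite ltr_wpDr.
have L0 : 0 < L by rewrite ltr_wpDr.
have mu0 : 0 < mu by rewrite ltr_wpDr.
have c0 : 0 <= transport_rate n L := transport_rate_ge0 n (ltW L0).
have H0 : 0 < 1 + 2 * transport_rate n L + 2 * L.
  by rewrite ltr_wpDr ?mulr_ge0 ?(ltW L0) // ltr_wpDr // mulr_ge0.
have C0 : 0 < curve_defect b L mu := curve_defect_gt0 b0 L0 mu0.
have D40 : 0 <= increment_const n b L mu := increment_const_ge0 n b0 L0 mu0.
have D50 : 0 <= step_const n b L mu.
  apply: addr_ge0; first exact: mulr_ge0.
  exact: (splitting_const_ge0 n b0 L0 mu0).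
pose K1 := increment_const n b L mu + step_const n b L mu + 2 * curve_defect b L mu.
(* h <= h0 forces h <= 1, h L <= 1/2 and h times the transport rate <= 1/2. *)
exists (1 + 2 * transport_rate n L + 2 * L)^-1, K1.
split=> [|T T0]; first by rewrite invr_gt0.
pose K2 := expR (2 * L * T) * (1 + T * K1); exists K2.
move=> eps F [cF F_bound F_lip eps0 F_tan] CF bF h /andP[h0 hh].
have sF : @standing_assumptions R m n r T b L eps F.
  split=> //.
    move=> t X tT; apply: le_trans (F_bound t X tT) _.
    by rewrite /b; have := ler_norm B; lra.
  move=> t X Z tT; apply: le_trans (F_lip t X Z tT) _.
  by rewrite ler_wpM2r ?frob_ge0 // /L; have := ler_norm LF; lra.
have bF' : bounded_partials T 3 mu F.
  move=> a j t X aj tT; apply: le_trans (bF a j t X aj tT) _.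
  by rewrite lee_fin /mu; have := ler_norm M; lra.
have hsum : h + 2 * (h * transport_rate n L) + 2 * (h * L) <= 1.
  move: hh; rewrite -[_^-1]mul1r ler_pdivlMr //.
  by congr (_ <= _); ring.
have hc0 : 0 <= h * transport_rate n L by rewrite mulr_ge0 // ltW.
have hL0 : 0 <= h * L by rewrite mulr_ge0 // ltW.
have h1 : h <= 1 by lra.
have hc : h * transport_rate n L <= 1 / 2 by lra.
have hL : h * L <= 1 / 2 by lra.
have h40 : 0 <= h ^+ 4 by rewrite exprn_ge0 // ltW.
have local := heun_local rm rn b0 L0 mu0 sF CF bF' _ h0 h1 _ hc hL.
split.
  move=> t y0 y2 y3 y1 A /andP[t0 tT] [_ hV _] st _ A0 dA.
  have th : t + h <= T by rewrite -lerBrDr.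
  have [P [e1 e2 e3]] := local t y0 y2 y3 y1 t0 th hV st.
  have {}e3 : frob (P - A h) <= 2 * curve_defect b L mu * h ^+ 4.
    rewrite frobBC; apply: le_trans (e3 A _) _.
      by move=> s sh; apply: deriv_in_has_deriv; exact: dA.
    rewrite A0 subrr frob0 mulr0 add0r le_eqVlt; apply/orP; left; apply/eqP.
    by ring.
  have close Y c x : frob (Y - P) <= c * (h ^+ 4 + x) -> 0 <= x ->
      c <= increment_const n b L mu + step_const n b L mu ->
      frob (Y - A h) <= K1 * (h ^+ 4 + x).
    move=> hY x0 cle; apply: le_trans (frob_dist _ P _) _.
    rewrite /K1 mulrDl; apply: lerD.
      by apply: le_trans hY _; rewrite ler_wpM2r // addr_ge0.
    by apply: le_trans e3 _; rewrite ler_pM2l ?mulr_gt0 // lerDl.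
  split; first by apply: close e1 _ _; rewrite ?lerDl // mulr_ge0 ?sqr_ge0.
  by apply: close e2 _ _; rewrite ?lerDr // mulr_ge0 // ltW.
move=> t0 delta A y y2 y3 /andP[t00 t0T] dA hy0 hdelta steps N hN.
pose e k := frob (fmat (y k) - A (t0 + k%:R * h)).
have inT k : (k <= N)%N -> t0 + k%:R * h <= T.
  by move=> kN; apply: le_trans hN; rewrite lerD2l ler_wpM2r ?ler_nat // ltW.
have ranks k : (k <= N)%N -> is_rank_factors (y k).
  elim: k => [//|k IH kN]; have [_ hV _] := IH (ltnW kN).
  have [[_ _ st] [_ _ adm]] := steps k (inT _ kN).
  exact: KL_step_rank hV st adm.
have rec k : (k < N)%N ->
    e k.+1 <= (1 + 2 * L * h) * e k + h * (K1 * (eps + h ^+ 3)).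
  move=> kN; have [_ hV _] := ranks k (ltnW kN).
  have [st _] := steps k (inT _ kN).
  have tk0 : 0 <= t0 + k%:R * h by rewrite addr_ge0 // mulr_ge0 // ltW.
  have tkS : t0 + k%:R * h + h = t0 + k.+1%:R * h by rewrite -natr1; ring.
  have th : t0 + k%:R * h + h <= T by rewrite tkS; exact: inT.
  have [P [_ e2 e3]] := local _ _ _ _ _ tk0 th hV st.
  have {}e3 := e3 (fun s => A (t0 + k%:R * h + s)).
  rewrite /e; apply: le_trans (frob_dist _ P _) _.
  rewrite -tkS (frobBC P); apply: le_trans (lerD e2 (e3 _)) _.
    move=> s /andP[s0 sh]; apply: deriv_in_shift; rewrite addr0.
    apply: (@deriv_in_sub _ _ _ t0 T) => //; first by rewrite lerDl mulr_ge0 // ltW.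
    apply: deriv_in_has_deriv; apply: dA; apply/andP; split.
      by rewrite -addrA lerDl addr_ge0 // mulr_ge0 // ltW.
    by apply: le_trans th; rewrite lerD2l.
  rewrite addr0 (frobBC _ (fmat _)) addrCA lerD2l.
  have -> : step_const n b L mu * (h ^+ 4 + h * eps)
     + 2 * (h * (curve_defect b L mu * h ^+ 3))
    = h * (step_const n b L mu * (eps + h ^+ 3)
       + 2 * curve_defect b L mu * h ^+ 3) by ring.
  have g0 : 0 <= eps + h ^+ 3 by rewrite addr_ge0 // exprn_ge0 // ltW.
  rewrite ler_pM2l // /K1 [leRHS]mulrDl; apply: lerD.
    by rewrite ler_wpM2r // lerDr.
  by rewrite ler_pM2l ?mulr_gt0 // lerDr.
have g0 : 0 <= eps + h ^+ 3 by rewrite addr_ge0 // exprn_ge0 // ltW.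
have K10 : 0 <= K1 := addr_ge0 (addr_ge0 D40 D50) (mulr_ge0 (ler0n R 2) (ltW C0)).
have d0 : 0 <= delta by exact: le_trans (frob_ge0 _) hdelta.
have e0 : e 0%N <= delta by rewrite /e mul0r addr0.
have L20 : 0 <= 2 * L by rewrite mulr_ge0 // ltW.
have := recursion_bound L20 (mulr_ge0 K10 g0) (ltW h0) d0 e0 rec (leqnn N).
rewrite -/(e N) => hE; apply: le_trans hE _.
have NhT : N%:R * h <= T by move: hN; lra.
have Nh0 : 0 <= N%:R * h by rewrite mulr_ge0 // ltW.
rewrite /K2 -[leRHS]mulrA; apply: ler_pM; rewrite ?expR_ge0 //.
- exact: addr_ge0 d0 (mulr_ge0 Nh0 (mulr_ge0 K10 g0)).
- by rewrite ler_expR ler_wpM2l.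
have w1 : N%:R * h * (K1 * (eps + h ^+ 3)) <= T * K1 * (eps + h ^+ 3).
  by rewrite mulrA ler_wpM2r // ler_wpM2r.
have w2 : 0 <= T * K1 * delta by rewrite !mulr_ge0 // ltW.
have -> : (1 + T * K1) * (delta + eps + h ^+ 3) =
  delta + T * K1 * (eps + h ^+ 3) + (T * K1 * delta + (eps + h ^+ 3)) by ring.
apply: le_trans (lerD (lexx delta) w1) _.
by rewrite lerDl addr_ge0.
Qed.
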